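(* Let $G$ be a countable locally nilpotent group (every finitely generated subgroup of $G$ is nilpotent) acting freely and continuously on a zero-dimensional Polish space $X$. Then the orbit equivalence relation $E^X_G=\{(x,y): \exists g\in G,\ g\cdot x=y\}$ is continuously embeddable into $E_0$, i.e. there is a continuous injective map $f:X\to 2^{\mathbb{N}}$ such that for all $x,y\in X$, $x\mathrel{E^X_G}y \iff f(x)\mathrel{E_0}f(y)$.
   Context: $E_0$ is the equivalence relation on $2^{\mathbb{N}}$ given by $x\mathrel{E_0}y$ iff there is $n$ with $x(k)=y(k)$ for all $k\ge n$. The action is free if $g\cdot x\neq x$ for all $x\in X$ and all $g\neq 1_G$. $G$ is a discrete group and continuity of the action means each map $x\mapsto g\cdot x$ is continuous. *)

(* Defs.v *)
From HB Require Import structures.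
From mathcomp Require Import all_boot all_order all_algebra.
From mathcomp Require Import all_classical all_reals topology cantor.
From Stdlib Require Import Rdefinitions.
Set Implicit Arguments. Unset Strict Implicit. Unset Printing Implicit Defensive.
Local Open Scope classical_set_scope.

Definition is_group (G : Type) (mul : G -> G -> G) (one : G) (inv : G -> G) :=
  [/\ forall a b c, mul a (mul b c) = mul (mul a b) c,
      forall a, mul one a = a,
      forall a, mul a one = a,
      forall a, mul (inv a) a = one &
      forall a, mul a (inv a) = one].

Definition countable_type (G : Type) := exists f : G -> nat, injective f.

Inductive gen (G : Type) (mul : G -> G -> G) (one : G) (inv : G -> G)
  (S : set G) : G -> Prop :=
| gen_in : forall x, S x -> gen mul one inv S x
| gen_one : gen mul one inv S one
| gen_mul : forall x y, gen mul one inv S x -> gen mul one inv S y ->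
            gen mul one inv S (mul x y)
| gen_inv : forall x, gen mul one inv S x -> gen mul one inv S (inv x).

Definition commutator (G : Type) (mul : G -> G -> G) (inv : G -> G) (a b : G) :=
  mul (mul (inv a) (inv b)) (mul a b).

Fixpoint lcs (G : Type) (mul : G -> G -> G) (one : G) (inv : G -> G)
  (H : set G) (n : nat) : set G :=
  match n with
  | 0 => H
  | n.+1 => gen mul one inv
      [set c | exists a b, lcs mul one inv H n a /\ H b /\ c = commutator mul inv a b]
  end.

Definition nilpotent_subgroup (G : Type) (mul : G -> G -> G) (one : G)
  (inv : G -> G) (H : set G) :=
  exists n, forall x, lcs mul one inv H n x -> x = one.

Definition locally_nilpotent (G : Type) (mul : G -> G -> G) (one : G)
  (inv : G -> G) :=
  forall F : set G, finite_set F -> nilpotent_subgroup mul one inv (gen mul one inv F).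

Definition zero_dim (T : topologicalType) :=
  exists B : set_system T, (forall A, B A -> clopen A) /\ basis B.

Definition is_metric (T : Type) (d : T -> T -> R) :=
  [/\ forall x y, Rle R0 (d x y),
      forall x y, d x y = R0 <-> x = y,
      forall x y, d x y = d y x &
      forall x y z, Rle (d x z) (Rplus (d x y) (d y z))].

Definition metric_compatible (T : topologicalType) (d : T -> T -> R) :=
  forall A : set T, open A <->
    (forall x, A x -> exists e, Rlt R0 e /\ [set y | Rlt (d x y) e] `<=` A).

Definition metric_complete (T : Type) (d : T -> T -> R) :=
  forall u : nat -> T,
    (forall e, Rlt R0 e -> exists N, forall m n, (N <= m)%N -> (N <= n)%N ->
        Rlt (d (u m) (u n)) e) ->
    exists l, forall e, Rlt R0 e -> exists N, forall n, (N <= n)%N -> Rlt (d (u n) l) e.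

Definition polish (T : topologicalType) :=
  (exists D : set T, countable D /\ closure D = setT) /\
  (exists d : T -> T -> R, [/\ is_metric d, metric_compatible d & metric_complete d]).

Definition E0 (x y : cantor_space) := exists n, forall k, (n <= k)%N -> x k = y k.

(* Main.v *)
(* The orbit relation embeds into [E0] as soon as there are continuous maps
   [z n] moving each point within its orbit, by finitely many group elements,
   such that [z n (g x) = z n x] for all large [n]: encode [x] by the group
   element carrying [z n x] to [z n.+1 x] and by finitely many bits of finitely
   many translates of [z n x], for all [n].

   Let [K l] be an increasing sequence of finitely generated subgroups
   exhausting [G]. Since [K l] is nilpotent there is a constant [c l] such that
   every finite [A] in [K l] admits a finite [Q] in [K l] for which [Q Q^-1 Q A]
   has at most [c l * #|Q|] elements. Sending a point to a nearby element of a
   clopen maximal [Q^-1 Q]-discrete set, we get cell maps [p l] taking at most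
   [c l] values on each [A x].

   The map [z n] is a composite of modifications of [p 0], ..., [p n]. At level
   [l] the current cell map [H] is composed with the map [e] coming from the
   higher levels, and wherever [e o H] takes two values near a point, [H] is
   modified around it so as to take fewer values there. The number of values is
   at most [c l], so around each point fewer than [c l] of the composites can
   vary. A modification loses some radius of control; this is affordable because
   the level [l.+1] already bounds by [c l.+1] the number of modifications
   affecting a given place. *)
Require Import Defs.
From Stdlib Require Reals Lra.
Import Rdefinitions.
From HB Require Import structures.
From mathcomp Require Import all_boot all_order all_algebra.
From mathcomp Require Import all_classical all_reals topology cantor.
From mathcomp Require Import zify.
Set Implicit Arguments. Unset Strict Implicit. Unset Printing Implicit Defensive.
Local Open Scope classical_set_scope.
Local Open Scope group_scope.

(** * Tilings of nilpotent groups *)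

Section Tiling.
Context (G : groupType).
Implicit Types (K N : set G) (x y t : G).

Definition subgroup N :=
  [/\ N 1, forall x y, N x -> N y -> N (x * y) & forall x, N x -> N x^-1].

Definition normalized K N := forall k x, K k -> N x -> N (x ^ k).

Definition cong N x y := N (x^-1 * y).

(* With [N = 1], the condition on [Q] is [|Q Q^-1 Q A| <= c |Q|]. *)
Definition tiles K N c := forall A : seq G, {in A, forall a, K a} ->
  exists Q R : seq G, [/\ Q != [::], {in Q, forall q, K q},
    uniq Q /\ {in Q &, forall p q, cong N p q -> p = q},
    {in Q & Q, forall p q, {in Q & A, forall r a,
        exists2 x, x \in R & cong N x (p * q^-1 * r * a)}} &
    (size R <= c * size Q)%N].

Section Cong.
Context (K N : set G) (gK : subgroup K) (gN : subgroup N) (nN : normalized K N).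

Lemma cong_refl x : cong N x x.
Proof. by case: gN => N1 _ _; rewrite /cong mulVg. Qed.

Lemma cong_sym x y : cong N x y -> cong N y x.
Proof. by case: gN => _ _ NV /NV; rewrite /cong invgM invgK. Qed.

Lemma cong_trans y x z : cong N x y -> cong N y z -> cong N x z.
Proof.
case: gN => _ NM _ xy yz; move: (NM _ _ xy yz).
by rewrite /cong !mulgA mulgK.
Qed.

Lemma cong_mull z x y : cong N x y -> cong N (z * x) (z * y).
Proof. by rewrite /cong invgM -!mulgA mulKg. Qed.

Lemma cong_mulr z x y : K z -> cong N x y -> cong N (x * z) (y * z).
Proof. by move=> Kz /(nN Kz); rewrite /cong conjgE invgM !mulgA. Qed.

End Cong.

Lemma ex_reps N (gN : subgroup N) (s : seq G) : exists P : seq G,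
  [/\ uniq P, {subset P <= s}, {in P &, forall p q, cong N p q -> p = q} &
      {in s, forall x, exists2 u, u \in P & cong N u x}].
Proof.
elim: s => [|x s [P [uP sP dP cP]]]; first by exists [::].
case: (pselect (exists2 u, u \in P & cong N u x)) => [ex|nex].
  exists P; split=> //; first by move=> p /sP; rewrite in_cons orbC => ->.
  by move=> y; rewrite in_cons => /orP[/eqP->//|/cP].
exists (x :: P); split.
- rewrite /= uP andbT; apply/negP => xP; apply: nex; exists x => //.
  exact: cong_refl.
- move=> p; rewrite !in_cons => /orP[->//|/sP ->]; exact: orbT.
- move=> p q; rewrite !in_cons => /orP[/eqP->|pP] /orP[/eqP->|qP] //.
  + by move=> /(cong_sym gN) xq; case: nex; exists q.
  + by move=> px; case: nex; exists p.
  + exact: dP.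
- move=> y; rewrite in_cons => /orP[/eqP->|/cP[u uP' uy]].
    by exists x; rewrite ?mem_head//; exact: cong_refl.
  by exists u; rewrite // in_cons uP' orbT.
Qed.

Lemma uniform_bound (T : eqType) (P : T -> nat -> Prop) (s : seq T) :
  (forall w m n, (m <= n)%N -> P w m -> P w n) ->
  {in s, forall w, exists m, P w m} -> exists m, {in s, forall w, P w m}.
Proof.
move=> mono; elim: s => [|w s IHs] ex; first by exists 0.
have [|m Pm] := IHs; first by move=> v vs; apply: ex; rewrite in_cons vs orbT.
have [n Pn] := ex w (mem_head _ _).
exists (maxn m n) => v; rewrite in_cons => /orP[/eqP->|vs].
  by apply: mono Pn; exact: leq_maxr.
by apply: mono (Pm v vs); exact: leq_maxl.
Qed.

(** * Passing from a modulus to a smaller one by a central element *)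

Section Adjoin.
Context (K N : set G) (gK : subgroup K) (gN : subgroup N) (nN : normalized K N).
Context (t : G) (Kt : K t) (ct : forall k, K k -> N [~ t, k]).

(** The integer power of [t] with exponent [i - j], kept as two natural exponents. *)
Let z i j : G := t ^+ i * t ^- j.

Let zM i j i' j' : z i j * z i' j' = z (i + i') (j + j').
Proof.
have cVX m n : t ^- m * t ^+ n = t ^+ n * t ^- m.
  by apply: commute_sym; apply: commuteV; apply: commuteX2.
by rewrite /z !expgnDr invgM -!mulgA; congr (_ * _); rewrite !mulgA cVX -!mulgA
   -!invgM -!expgnDr addnC.
Qed.

Let zE i j i' j' : (i + j')%N = (i' + j)%N -> z i j = z i' j'.
Proof.
move=> e; apply: (@mulIg _ (z (j + j') 0)); rewrite !zM.
have zz m n : z (m + n) (n + 0) = t ^+ m by rewrite /z addn0 expgnDr mulgK.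
have -> : (i + (j + j') = (i + j') + j)%N by lia.
rewrite zz.
have -> : (i' + (j + j') = (i' + j) + j')%N by lia.
by rewrite zz e.
Qed.

Let Kz i j : K (z i j).
Proof.
have [K1 KM KV] := gK; have KX n : K (t ^+ n).
  by elim: n => [|n IHn]; rewrite ?expg0// expgS; apply: KM.
by apply: (KM _ _ (KX _)); apply: KV.
Qed.

Let zC k i j : K k -> cong N (k * z i j) (z i j * k).
Proof.
move=> Kk.
have [K1 KM KV] := gK; have [N1 NM NV] := gN.
have cM u v : K u -> K v -> (forall k, K k -> cong N (k * u) (u * k)) ->
    (forall k, K k -> cong N (k * v) (v * k)) ->
    forall k, K k -> cong N (k * (u * v)) ((u * v) * k).
  move=> Ku Kv cu cv h Kh; apply: (cong_trans gN (y := (u * h) * v)).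
    by rewrite mulgA; apply: cong_mulr; [exact: nN| |exact: cu].
  by rewrite -!mulgA; apply: cong_mull; exact: cv.
have cV u : K u -> (forall k, K k -> cong N (k * u) (u * k)) ->
    forall k, K k -> cong N (k * u^-1) (u^-1 * k).
  move=> Ku cu h Kh; apply: (cong_sym gN).
  have := cong_mull u^-1 (cong_mulr nN (KV _ Ku) (cu h Kh)).
  by rewrite mulgK mulgA mulKg.
have ct' h : K h -> cong N (h * t) (t * h).
  by move=> Kh; move: (ct Kh); rewrite /cong /commg /conjg invgM !mulgA.
have c1 h : K h -> cong N (h * 1) (1 * h).
  by move=> _; rewrite mulg1 mul1g; exact: cong_refl.
have KX n : K (t ^+ n).
  by elim: n => [|n IHn]; rewrite ?expg0// expgS; apply: KM.
have cX n : forall h, K h -> cong N (h * t ^+ n) (t ^+ n * h).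
  elim: n => [|n IHn] h Kh; first by rewrite expg0; exact: c1.
  by rewrite expgS; apply: cM.
by apply: (cM _ _ (KX i) (KV _ (KX j)) (cX i) (cV _ (KX j) (cX j))).
Qed.

Let shuffle q r a z1 z2 z3 : K q -> K r -> K a -> K z1 -> K z2 -> K z3 ->
  (forall k, K k -> cong N (k * z1) (z1 * k)) ->
  (forall k, K k -> cong N (k * z2) (z2 * k)) ->
  (forall k, K k -> cong N (k * z3) (z3 * k)) ->
  z1 * (z2 * z3) = z3 * (z2 * z1) ->
  cong N (z1 * (z2 * (q * (r * (z3 * a))))) (q * (r * (a * (z1 * (z2 * z3))))).
Proof.
move=> Kq Kr Ka K1 K2 K3 c1 c2 c3 ->; have [_ KM _] := gK.
have KW : K (q * (r * (z3 * a))) by repeat (apply KM => //).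
apply: (cong_trans gN (y := (q * (r * (z3 * a)) * z2) * z1)).
  apply: (cong_trans gN (y := ((z2 * (q * (r * (z3 * a)))) * z1))).
    by apply: (cong_sym gN); apply: c1; apply: KM.
  by apply: (cong_mulr nN K1); apply: (cong_sym gN); exact: c2.
rewrite -!mulgA; do 2!apply: cong_mull; rewrite !mulgA.
apply: (cong_mulr nN K1); apply: (cong_mulr nN K2).
by apply: (cong_sym gN); exact: c3.
Qed.

(** The subgroup generated by [N] and [t], given as the union of the cosets of the powers of [t]. *)
Definition adjoin : set G := [set x | exists i j, cong N (t ^+ i * t ^- j) x].

Lemma adjoin_sub x : N x -> adjoin x.
Proof.
by move=> Nx; exists 0, 0; rewrite /cong expg0 mulgV invg1 mul1g.
Qed.

Lemma adjoin_id : adjoin t.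
Proof. by exists 1%N, 0; rewrite expg0 invg1 mulg1 expg1; exact: cong_refl. Qed.

Context (NK : forall x, N x -> K x).

Let adjK x : adjoin x -> K x.
Proof.
move=> [i [j c]]; have [K1 KM KV] := gK.
by rewrite -(mulVKg (z i j) x); apply: KM => //; exact: NK.
Qed.

Lemma adjoin_subgroup : subgroup adjoin.
Proof.
have [K1 KM KV] := gK; have [N1 NM NV] := gN.
split; first exact: adjoin_sub.
- move=> x y ax [i' [j' c']]; have Kx := adjK ax.
  move: ax => [i [j c]].
  exists (i + i')%N, (j + j')%N; rewrite -/(z _ _) -zM.
  apply: (cong_trans gN (y := x * z i' j')); last exact: cong_mull.
  exact: (cong_mulr nN).
- move=> x ax; have Kx := adjK ax; move: ax => [i [j c]].
  exists j, i; rewrite -/(z j i); rewrite -/(z i j) in c.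
  have e : z j i * z i j = 1.
    by rewrite zM (@zE _ _ 0 0) ?addn0 1?addnC// /z expg0 invg1 mulg1.
  have := cong_mull (z j i) (cong_mulr nN (KV _ Kx) c); rewrite mulgV mulg1 mulgA e mul1g.
  exact: (cong_sym gN).
Qed.

Lemma adjoin_normalized : normalized K adjoin.
Proof.
have [K1 KM KV] := gK; have [N1 NM NV] := gN.
move=> k x Kk [i [j c]]; exists i, j; rewrite -/(z i j).
rewrite conjgE.
apply: (cong_trans gN (y := k^-1 * (z i j * k))).
  by rewrite -{1}(mulKg k (z i j)); apply: cong_mull; exact: zC.
by apply: cong_mull; exact: (cong_mulr nN).
Qed.

Lemma adjoinK x : adjoin x -> K x. Proof. exact: adjK. Qed.

(** Multiply a tile [Q0] modulo [adjoin] by a long interval of powers of [t]. These powers commute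
    with [K] modulo [N], so the new products are the old ones times an interval of powers at most
    five times as long. The factor 5 does not depend on [A]. *)
Lemma tiles_adjoin c : tiles K adjoin c -> tiles K N (5 * c).
Proof.
have [K1 KM KV] := gK; have [N1 NM NV] := gN.
move=> tl A KA; have [Q0 [R0 [Q0n KQ0 [uQ0 dQ0] cov sz]]] := tl A KA.
pose s := [seq a.1 * a.2 | a <-
  [seq (b.1 * b.2, r) | b <- [seq (p, q^-1) | p <- Q0, q <- Q0],
                        r <- [seq r * a | r <- Q0, a <- A]]].
pose P w m := exists2 x, x \in R0 & exists i j,
  [/\ (i <= m)%N, (j <= m)%N & cong N (x * z i j) w].
have [||M PM] := @uniform_bound _ P s.
- move=> w m n le_mn [x xR [i [j [im jm cw]]]].
  exists x => //; exists i, j; split=> //.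
    exact: leq_trans im le_mn.
  exact: leq_trans jm le_mn.
- move=> w /mapP[a /allpairsP[[b r] /= [/allpairsP[[p q] /= [pQ qQ ->]]]]].
  move=> /allpairsP[[r' a'] /= [rQ aA ->]] -> -> /=.
  have [x xR [i [j cx]]] := cov p q pQ qQ r' a' rQ aA.
  exists (maxn i j), x => //; exists i, j; split; rewrite ?leq_maxl ?leq_maxr//.
  by have := cong_mull x cx; rewrite mulVKg -(mulgA _ r' a').
(* [L] exceeds every exponent needed to write the old products through [R0]. Since [t] may have
   finite order modulo [N], [P0] keeps one power per coset. *)
pose L := M.+1; have [I5 I5E] : exists s, s = iota 0 5 by eexists.
have [P0 [uP sP dP cP]] := ex_reps gN [seq t ^+ i | i <- iota 0 L].
have P0E u : u \in P0 -> exists2 i, (i < L)%N & u = z i 0.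
  move=> /sP /mapP[i]; rewrite mem_iota /= add0n => iL ->; exists i => //.
  by rewrite /z expg0 invg1 mulg1.
exists [seq q * u | q <- Q0, u <- P0].
exists [seq x * u | x <- [seq x * z (k * L) (M + L) | x <- R0, k <- I5], u <- P0].
have P0n : P0 != [::].
  have : (t ^+ 0) \in [seq t ^+ i | i <- iota 0 L].
    by apply/mapP; exists 0; rewrite ?mem_iota.
  by move=> /cP[u + _]; case: (P0).
have distinct q u q' u' : q \in Q0 -> u \in P0 -> q' \in Q0 -> u' \in P0 ->
    cong N (q * u) (q' * u') -> (q, u) = (q', u').
  move=> qQ uP' qQ' uP'' cc.
  have [_ aM aV] := adjoin_subgroup.
  have azu v : v \in P0 -> adjoin v.
    by move=> /P0E[i _ ->]; exists i, 0; exact: cong_refl.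
  have eq : q = q'.
    apply: dQ0 => //; rewrite /cong.
    have -> : q^-1 * q' = (u * ((q * u)^-1 * (q' * u'))) * u'^-1.
      by rewrite invgM !mulgA mulgV mul1g mulgK.
    by apply: (aM _ _ (aM _ _ (azu _ uP') (adjoin_sub cc)) (aV _ (azu _ uP''))).
  rewrite eq in cc *; congr pair; apply: dP => //.
  by move: cc; rewrite /cong invgM -!mulgA mulKg.
split.
- by case: (Q0) Q0n => //= q ? _; case: (P0) P0n.
- move=> x /allpairsP[[q u] /= [qQ uP' ->]]; apply: KM; first exact: KQ0.
  by have [i _ ->] := P0E u uP'.
- split.
    apply: allpairs_uniq => // -[q u] [q' u'] /allpairsP[[? ?] /= [h1 h2 [-> ->]]].
    move=> /allpairsP[[? ?] /= [h3 h4 [-> ->]]] /= e; apply: distinct => //.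
    by rewrite e; exact: cong_refl.
  move=> x y /allpairsP[[q u] /= [qQ uP' ->]] /allpairsP[[q' u'] /= [qQ' uP'' ->]].
  by move=> /distinct-/(_ qQ uP' qQ' uP'')[-> ->].
- move=> x1 x2 /allpairsP[[p u1] /= [pQ u1P ->]] /allpairsP[[q u2] /= [qQ u2P ->]].
  move=> x3 a /allpairsP[[r u3] /= [rQ u3P ->]] aA.
  have [i1 l1 ->] := P0E _ u1P; have [i2 l2 ->] := P0E _ u2P.
  have [i3 l3 ->] := P0E _ u3P.
  have zV i : (z i 0)^-1 = z 0 i by rewrite /z expg0 invg1 mulg1 mul1g.
  rewrite invgM zV.
  have ws : p * q^-1 * (r * a) \in s.
    apply/mapP; exists (p * q^-1, r * a) => //.
    by apply/allpairsP; exists ((p, q^-1), r * a); split=> //=; apply/allpairsP;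
      [exists (p, q)|exists (r, a)].
  have [x xR [i [j [iM jM cx]]]] := PM _ ws.
  (* The exponent [i - j + i1 - i2 + i3], shifted by [M + L] to be natural. It is below [5 * L], so
     division by [L] selects one of five translates of [P0]. *)
  pose e := (i + i1 + i3 + (M - j) + (L - i2))%N.
  have [eL eE] : (e < 5 * L)%N /\ (e + (j + i2) = i + (i1 + i3) + (M + L))%N.
    by rewrite /e; clear -l1 l2 l3 iM jM; rewrite /L in l1 l2 l3 *; lia.
  have [u uP' cu] : exists2 u, u \in P0 & cong N u (t ^+ (e %% L)).
    by apply: cP; apply/mapP; exists (e %% L)%N; rewrite // mem_iota /= add0n ltn_mod.
  exists (x * z (e %/ L * L) (M + L) * u).
    apply/allpairsP; exists (x * z (e %/ L * L) (M + L), u); split=> //.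
    apply/allpairsP; exists (x, e %/ L)%N; split=> //.
    by rewrite I5E mem_iota leq0n add0n /= ltn_divLR.
  have Kq := KQ0 _ qQ; have Kr := KQ0 _ rQ; have Ka := KA _ aA; have Kp := KQ0 _ pQ.
  apply: (cong_trans gN (y := x * z i j * z (i1 + i3) i2)).
    apply: (cong_trans gN (y := x * z (e %/ L * L) (M + L) * z (e %% L) 0)).
      by apply: cong_mull; rewrite /z expg0 invg1 mulg1.
    rewrite -!(mulgA x) !zM; apply: cong_mull; rewrite -divn_eq addn0.
    rewrite (@zE e (M + L)%N (i + (i1 + i3))%N (j + i2)%N); first exact: cong_refl.
    exact: eE.
  apply: (cong_trans gN (y := p * q^-1 * (r * a) * z (i1 + i3) i2)).
    exact: (cong_mulr nN).
  apply: (cong_sym gN).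
  have -> : p * z i1 0 * (z 0 i2 * q^-1) * (r * z i3 0) * a =
    p * (z i1 0 * (z 0 i2 * (q^-1 * (r * (z i3 0 * a))))) by rewrite !mulgA.
  have -> : p * q^-1 * (r * a) * z (i1 + i3) i2 =
    p * (q^-1 * (r * (a * z (i1 + i3) i2))) by rewrite !mulgA.
  apply: cong_mull.
  have -> : z (i1 + i3) i2 = z i1 0 * (z 0 i2 * z i3 0).
    by rewrite !zM !add0n addn0.
  apply: shuffle => //; try by [exact: KV|move=> k Kk; exact: zC].
  by rewrite !zM !add0n addnC.
- rewrite !size_allpairs I5E size_iota mulnA leq_mul2r; apply/orP; right.
  by rewrite mulnC -mulnA leq_mul2l sz orbT.
Qed.

End Adjoin.
End Tiling.

(** * Tilings from a central series *)

Section Nilpotent.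
Context (G : groupType).
Implicit Types (K N : set G) (F : seq G).

Definition generated F : set G := gen *%g 1 (fun x : G => x^-1) [set` F].

Lemma generated_subgroup F : subgroup (generated F).
Proof.
by split; [exact: gen_one|exact: gen_mul|exact: gen_inv].
Qed.

Lemma generated_min F N : subgroup N -> {in F, forall x, N x} ->
  forall x, generated F x -> N x.
Proof.
move=> [N1 NM NV] FN x; elim=> {x} [x /FN//|//|x y _ Nx _ Ny|x _ Nx].
- exact: NM.
- exact: NV.
Qed.

Lemma generated_mono F F' : {subset F <= F'} ->
  forall x, generated F x -> generated F' x.
Proof.
move=> sF; apply: generated_min; first exact: generated_subgroup.
by move=> x /sF Fx; apply: gen_in.
Qed.

Fixpoint commutators (S : seq G) n : seq G :=
  if n is n.+1 then [seq [~ a, s] | a <- commutators S n, s <- S] else S.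

Lemma commutators_lcs S n x : x \in commutators S n ->
  lcs *%g 1 (fun x : G => x^-1) (generated S) n x.
Proof.
elim: n x => [|n IHn] x /=; first by move=> xS; apply: gen_in.
move=> /allpairsP[[a s] /= [/IHn an sS ->]]; apply: gen_in; exists a, s.
split=> //; split; first exact: gen_in.
by rewrite /commutator /commg conjgE -!mulgA.
Qed.

(* The subgroup generated by all commutators of weight at least [i], built by
   adjoining them one at a time, each central modulo the previous ones. *)
Lemma central_chain S n : {in S, forall s, s^-1 \in S} ->
  {in commutators S n, forall x, x = 1} ->
  forall j, (j <= n)%N -> exists N, [/\ subgroup N, normalized (generated S) N,
    (forall x, N x -> generated S x), {in commutators S (n - j), forall x, N x} &
    forall c, tiles (generated S) N c ->
      exists c', tiles (generated S) [set 1] c'].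
Proof.
move=> SV Sn; set K := generated S.
have gK : subgroup K := generated_subgroup S.
have SK : {in S, forall s, K s} by move=> s sS; apply: gen_in.
elim=> [_|j IHj jn].
  exists [set 1]; rewrite subn0; split=> //.
  - by split=> [//|x y -> ->|x ->] /=; rewrite ?mulg1 ?invg1.
  - by move=> k x _ ->; rewrite /= conj1g.
  - by move=> x ->; case: gK.
  - by move=> c tl; exists c.
have [N [gN nN NK CN tN]] := IHj (ltnW jn).
have -> : (n - j.+1 = (n - j).-1)%N by lia.
have : (n - j)%N = ((n - j).-1).+1 by lia.
move: (n - j).-1 => i ei; rewrite ei /= in CN.
have CK : {in commutators S i, forall x, K x}.
  elim: i {CN ei} => [|i IHi] x /=; first exact: SK.
  move=> /allpairsP[[a s] /= [/IHi Ka /SK Ks ->]].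
  rewrite /commg conjgE; have [_ KM KV] := gK.
  by repeat first [assumption|apply KM|apply KV].
(* The commutator identities for products and inverses reduce the claim to generators [s], where
   [[~ t, s]] is one of the heavier commutators already in [N]. *)
have central t : t \in commutators S i -> forall k, K k -> N [~ t, k].
  move=> tC; have Kt := CK _ tC; have [N1 NM NV] := gN; have [K1 KM KV] := gK.
  move=> k; rewrite /K /generated; elim=> {k} [s sS||k l Kk Nk Kl Nl|k Kk Nk].
  - by apply: CN; apply/allpairsP; exists (t, s).
  - by rewrite commg1.
  - have -> : [~ t, k * l] = [~ t, l] * [~ t, k] ^ l.
      by rewrite /commg !conjgE !invgM -!mulgA !mulVKg.
    by apply: NM => //; apply: nN.
  - have -> : [~ t, k^-1] = ([~ t, k]^-1) ^ (k^-1).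
      by rewrite invgR /commg !conjgE invgK -!mulgA mulVKg.
    by apply: nN; [exact: KV|exact: NV].
suff [M [gM nM MK _ [CM tM]]] : exists M, [/\ subgroup M, normalized K M,
    (forall x, M x -> K x), (forall x, N x -> M x) &
    {in commutators S i, forall x, M x} /\
    forall c, tiles K M c -> exists c', tiles K [set 1] c'].
  by exists M; split.
elim: (commutators S i) central CK => [|t ts IHt] cen CK.
  by exists N; split=> //; split.
have [||M [gM nM MK NM [CM tM]]] := IHt.
- by move=> u us; apply: cen; rewrite in_cons us orbT.
- by move=> u us; apply: CK; rewrite in_cons us orbT.
have Kt : K t by apply: CK; exact: mem_head.
have ct k : K k -> M [~ t, k].
  by move=> Kk; apply: NM; apply: cen => //; exact: mem_head.
exists (adjoin M t); split.
- exact: (adjoin_subgroup gK gM nM Kt MK).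
- by move=> k x; apply: (adjoin_normalized gK gM nM Kt ct).
- by move=> x; exact: (adjoinK gK Kt MK).
- by move=> x /NM; exact: adjoin_sub.
- split.
    move=> x; rewrite in_cons => /orP[/eqP->|/CM]; first exact: adjoin_id.
    exact: adjoin_sub.
  move=> c tc; apply: (tM (5 * c)%N); exact: (tiles_adjoin gK gM nM Kt ct MK tc).
Qed.

(** The last subgroup of the chain contains the generators, hence all of [K]; modulo it the tile
    [{1}] works with constant 1. Going back down the chain, each adjoined commutator multiplies the
    constant by 5. *)
Lemma nilpotent_tiles F : nilpotent_subgroup *%g 1 (fun x : G => x^-1) (generated F) ->
  exists c, tiles (generated F) [set 1] c.
Proof.
pose S := F ++ [seq x^-1 | x <- F] => -[n Kn].
have SV : {in S, forall s, s^-1 \in S}.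
  move=> s; rewrite !mem_cat => /orP[sF|/mapP[x xF ->]].
    by apply/orP; right; apply/mapP; exists s.
  by rewrite invgK xF.
have FS : generated F = generated S.
  apply/seteqP; split=> x.
    by apply: generated_mono => y yF; rewrite mem_cat yF.
  apply: generated_min; first exact: generated_subgroup.
  move=> y; rewrite mem_cat => /orP[yF|/mapP[z zF ->]]; first exact: gen_in.
  by apply: gen_inv; apply: gen_in.
rewrite FS in Kn *.
have [|N [gN nN NK CN tN]] := @central_chain S n SV _ n (leqnn n).
  by move=> x /commutators_lcs /Kn.
rewrite subnn /= in CN; apply: (tN 1%N) => A KA.
have [N1 NM NV] := gN.
exists [:: 1], [:: 1]; split=> //.
- by move=> q /[!inE] /eqP ->; exact: gen_one.
- by split=> // p q /[!inE] /eqP -> /eqP ->.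
- move=> p q /[!inE] /eqP -> /eqP -> r a /[!inE] /eqP -> aA.
  exists 1; rewrite ?inE// /cong invg1 !mul1g.
  exact: generated_min gN CN _ (KA _ aA).
Qed.

End Nilpotent.

(** * Locally constant constructions *)

Section Action.
Context (G : groupType) (X : topologicalType) (act : G -> X -> X).
Context (act1 : forall x, act 1 x = x).
Context (actM : forall g h x, act (g * h) x = act g (act h x)).
Context (free : forall g x, act g x = x -> g = 1).
Context (cont : forall g, continuous (act g)).
Context (bit : nat -> X -> bool).
Context (bit_loc : forall n x, \forall y \near x, bit n y = bit n x).
Context (bit_sep : forall x y, (forall n, bit n x = bit n y) -> x = y).
Context (bit_basis : forall x U, nbhs x U ->
  exists n, bit n x /\ forall y, bit n y -> U y).

Definition locally_constant T (f : X -> T) :=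
  forall x : X, \forall y \near x, f y = f x.

Definition piecewise (f : X -> X) :=
  forall x : X, exists g, \forall y \near x, f y = act g y.

Lemma act_free g h x : act g x = act h x -> g = h.
Proof.
move=> e; apply: (mulgI h^-1); rewrite mulVg.
by apply: (@free _ x); rewrite actM e -actM mulVg act1.
Qed.

Lemma near_act g x (P : X -> Prop) :
  (\forall y \near act g x, P y) -> \forall y \near x, P (act g y).
Proof. by move=> Px; apply: (cont Px). Qed.

Lemma piecewise_id : piecewise id.
Proof.
by move=> x; exists 1; near=> y; rewrite act1.
Unshelve. all: by end_near.
Qed.

Lemma piecewise_comp f h : piecewise f -> piecewise h -> piecewise (f \o h).
Proof.
move=> pf ph x; have [g hx] := ph x; have [g' fx] := pf (act g x).
exists (g' * g); near=> y; rewrite /= actM.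
have -> : h y = act g y by near: y.
by near: y; exact: (near_act fx).
Unshelve. all: by end_near.
Qed.

Lemma piecewise_act g f : piecewise f -> piecewise (fun x => f (act g x)).
Proof.
by move=> pf; apply: (@piecewise_comp f (act g) pf) => x; exists g; near=> y.
Unshelve. all: by end_near.
Qed.

Lemma piecewise_locally_constant (f : X -> G) : locally_constant f ->
  piecewise (fun x => act (f x) x).
Proof. by move=> lf x; exists (f x); apply: filterS (lf x) => y ->. Qed.

Lemma locally_constant_comp T f (h : X -> T) : piecewise f ->
  locally_constant h -> locally_constant (h \o f).
Proof.
move=> pf lh x; have [g fx] := pf x; have /near_act hx := lh (act g x).
near=> y; have fxx : f x = act g x by exact: nbhs_singleton fx.
rewrite /= fxx; have -> : f y = act g y by near: y.
by near: y.
Unshelve. all: by end_near.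
Qed.

(** If the maps act near [x] by [g] and [g'], freeness turns equality at a point into [g = g'],
    which does not mention the point. *)
Lemma locally_constant_eq f h : piecewise f -> piecewise h ->
  locally_constant (fun x => f x == h x).
Proof.
move=> pf ph x; have [g fx] := pf x; have [g' hx] := ph x.
have fxx : f x = act g x by exact: nbhs_singleton fx.
have hxx : h x = act g' x by exact: nbhs_singleton hx.
near=> y; have -> : f y = act g y by near: y.
have -> : h y = act g' y by near: y.
by rewrite fxx hxx; apply/eqP/eqP => /act_free ->.
Unshelve. all: by end_near.
Qed.

Definition lex x y := `[< exists n,
  [/\ forall i, (i < n)%N -> bit i x = bit i y, ~~ bit n x & bit n y] >].

Lemma lexx x : lex x x = false.
Proof. by apply/asboolP => -[n [_ /negbTE ->]]. Qed.

Lemma lex_first x y n : (forall i, (i < n)%N -> bit i x = bit i y) ->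
  bit n x != bit n y -> lex x y = bit n y.
Proof.
move=> xy; case xn: (bit n x); case yn: (bit n y) => // _.
  apply/asboolP => -[m [xym xm ym]].
  have [mn|nm|mn] := ltngtP m n; first by rewrite xy// ym in xm.
    by move: (xym _ nm); rewrite xn yn.
  by move: xm; rewrite mn xn.
by apply/asboolP; exists n; split; rewrite ?xn ?yn.
Qed.

Lemma first_difference x y : x <> y ->
  exists n, (forall i, (i < n)%N -> bit i x = bit i y) /\ bit n x != bit n y.
Proof.
move=> xy; have ex : exists n, bit n x != bit n y.
  apply/not_existsP => /= eq; apply: xy; apply: bit_sep => n.
  by apply/eqP; move: (eq n) => /negP; rewrite negbK.
exists (ex_minn ex); case: ex_minnP => n xyn minn; split=> // i.
by rewrite ltnNge => /(contra (minn i)); rewrite negbK => /eqP.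
Qed.

Lemma lex_total x y : x <> y -> lex x y \/ lex y x.
Proof.
move=> /first_difference[n [xy dn]].
rewrite (lex_first xy dn) (@lex_first y x n) 1?eq_sym//; last first.
  by move=> i /xy ->.
by move: dn; case: (bit n x); case: (bit n y) => //; [right|left].
Qed.

Lemma lex_trans x y z : lex x y -> lex y z -> lex x z.
Proof.
move=> /asboolP[m [xy xm ym]] /asboolP[n [yz yn zn]]; apply/asboolP.
have [mn|nm|mn] := ltngtP m n.
- exists m; split=> //; last by rewrite -yz.
  by move=> i im; rewrite xy// yz// (ltn_trans im).
- exists n; split=> //; last by rewrite xy.
  by move=> i im; rewrite xy ?yz// (ltn_trans im).
- by rewrite mn (negbTE yn) in ym.
Qed.

(** Either the two local elements coincide, and neither image is smaller anywhere nearby, or the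
    order is decided by finitely many bits, each locally constant. *)
Lemma locally_constant_lex f h : piecewise f -> piecewise h ->
  locally_constant (fun x => lex (f x) (h x)).
Proof.
move=> pf ph x; have [g fx] := pf x; have [g' hx] := ph x.
have fxx : f x = act g x by exact: nbhs_singleton fx.
have hxx : h x = act g' x by exact: nbhs_singleton hx.
have [e|/eqP ne] := eqVneq (act g x) (act g' x).
  near=> y; have -> : f y = act g y by near: y.
  have -> : h y = act g' y by near: y.
  by rewrite fxx hxx (act_free e) !lexx.
have [n [eqn dn]] := first_difference ne.
have nearbit k i : \forall y \near x, bit i (act k y) = bit i (act k x).
  exact: near_act (bit_loc i _).
have nearbits k : \forall y \near x,
    forall i, (i < n.+1)%N -> bit i (act k y) = bit i (act k x).
  elim: n.+1 => [|m IHm]; first by near=> y.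
  near=> y => i; rewrite ltnS leq_eqVlt => /orP[/eqP ->|].
    by near: y; exact: nearbit.
  by move: i; near: y; exact: IHm.
near=> y; have -> : f y = act g y by near: y.
have -> : h y = act g' y by near: y.
have gy : forall i, (i < n.+1)%N -> bit i (act g y) = bit i (act g x)
  by near: y; exact: nearbits.
have gy' : forall i, (i < n.+1)%N -> bit i (act g' y) = bit i (act g' x)
  by near: y; exact: nearbits.
rewrite fxx hxx (lex_first eqn dn) (@lex_first _ _ n) ?gy ?gy'// => i im.
by rewrite gy ?gy' ?eqn// ltnW.
Unshelve. all: by end_near.
Qed.

(** The comparison is strict, so ties keep the current candidate; started at 1, the search stays at
    1 where [e] is constant. *)
Fixpoint pick_min (e : X -> X) (A : seq G) (b : G) (x : X) : G :=
  if A is a :: A then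
    pick_min e A (if lex (e (act a x)) (e (act b x)) then a else b) x
  else b.

Lemma pick_min_in e A b x : pick_min e A b x \in b :: A.
Proof.
elim: A b => [|a A IHA] b /=; first by rewrite mem_head.
by move: (IHA (if lex (e (act a x)) (e (act b x)) then a else b));
  rewrite !in_cons; case: ifP => _ /orP[->|->]; rewrite ?orbT.
Qed.

Lemma pick_min_min e A b x a : a \in b :: A ->
  ~~ lex (e (act a x)) (e (act (pick_min e A b x) x)).
Proof.
elim: A b a => [|c A IHA] b a /=; first by rewrite inE => /eqP ->; rewrite lexx.
have [cb|ncb] := boolP (lex (e (act c x)) (e (act b x))).
  rewrite !in_cons => /orP[/eqP ->|]; last exact: IHA.
  apply/negP => bm; have := IHA c c (mem_head _ _).
  by rewrite (lex_trans cb bm).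
rewrite !in_cons => /or3P[/eqP ->|/eqP ->|aA]; first by apply: IHA; exact: mem_head.
  have := IHA b b (mem_head _ _); set m := pick_min _ _ _ _ => bm.
  apply/negP => cm; have [e'|ne] := pselect (e (act b x) = e (act m x)).
    by rewrite -e' (negbTE ncb) in cm.
  have [lt|lt] := lex_total ne; first by rewrite lt in bm.
  by rewrite (lex_trans cm lt) in ncb.
by apply: IHA; rewrite in_cons aA orbT.
Qed.

Lemma pick_min_id e A x : {in A, forall a, e (act a x) = e x} ->
  pick_min e A 1 x = 1.
Proof.
elim: A => //= a A IHA eA; rewrite eA ?mem_head// act1 lexx.
by apply: IHA => b bA; apply: eA; rewrite in_cons bA orbT.
Qed.

Lemma pick_min_loc e A b : piecewise e -> locally_constant (pick_min e A b).
Proof.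
move=> pe x; elim: A b => [|a A IHA] b /=; first by near=> y.
have lx := locally_constant_lex (piecewise_act a pe) (piecewise_act b pe) x.
near=> y; have -> : lex (e (act a y)) (e (act b y)) =
  lex (e (act a x)) (e (act b x)) by near: y.
by near: y; exact: IHA.
Unshelve. all: by end_near.
Qed.

(** * Reducing the number of cells at one scale *)

Definition products (A B : seq G) : seq G := [seq a * b | a <- A, b <- B].

Lemma mem_products A B a b : a \in A -> b \in B -> a * b \in products A B.
Proof. by move=> aA bB; apply/allpairsP; exists (a, b). Qed.

(** The power [B^(2^i)]: composing two displacements of one rung costs one rung. *)
Fixpoint ladder (B : seq G) i : seq G :=
  if i is i.+1 then products (ladder B i) (ladder B i) else B.

Definition varies (A : seq G) (E : X -> X) x := has (fun a => E (act a x) != E x) A.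

Lemma count_iotaS (P : pred nat) k :
  count P (iota 0 k.+1) = (count P (iota 0 k) + P k)%N.
Proof. by rewrite -addn1 iotaD count_cat /= addn0. Qed.

Definition displaced (D : seq G) (f : X -> X) :=
  forall x, exists2 d, d \in D & f x = act d x.

Section Ladder.
Context (B : seq G) (B1 : 1 \in B) (BV : {in B, forall b, b^-1 \in B}).
Local Notation L := (ladder B).

Lemma ladder1 i : 1 \in L i.
Proof. by elim: i => //= i IHi; rewrite -(mulg1 1) mem_products. Qed.

Lemma ladderV i : {in L i, forall a, a^-1 \in L i}.
Proof.
elim: i => //= i IHi a /allpairsP[[b c] /= [bL cL ->]].
by rewrite invgM mem_products ?IHi.
Qed.

Lemma ladderM i a b : a \in L i -> b \in L i -> a * b \in L i.+1.
Proof. exact: mem_products. Qed.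

Lemma ladder_le i j : (i <= j)%N -> {subset L i <= L j}.
Proof.
move=> /subnK <-; elim: (j - i)%N => // k IHk a /IHk aL.
by rewrite addSn -(mulg1 a); apply: ladderM => //; exact: ladder1.
Qed.

Lemma ladderM_le i j k a b : a \in L i -> b \in L j -> (i < k)%N -> (j < k)%N ->
  a * b \in L k.
Proof.
case: k => // k aL bL ik jk.
by apply: ladderM; [exact: ladder_le aL|exact: ladder_le bL].
Qed.

Lemma ladder_sub (K : set G) : subgroup K -> {in B, forall b, K b} ->
  forall i, {in L i, forall a, K a}.
Proof.
move=> [K1 KM KV] KB; elim=> //= i IHi a /allpairsP[[b c] /= [bL cL ->]].
by apply: KM; exact: IHi.
Qed.

Lemma varies_le i j E x : (i <= j)%N -> varies (L i) E x -> varies (L j) E x.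
Proof.
by move=> ij /hasP[a aL ne]; apply/hasP; exists a => //; exact: ladder_le aL.
Qed.

Lemma varies_shift i b E x : b \in L i -> varies (L i) E (act b x) ->
  varies (L i.+1) E x.
Proof.
move=> bL /hasP[a aL]; rewrite -actM => ne; apply/hasP.
have [e|ne'] := eqVneq (E (act b x)) (E x).
  by exists (a * b); [exact: ladderM|rewrite -e].
by exists b => //; apply: ladder_le bL.
Qed.

Lemma constant_near i E x : ~~ varies (L i) E x ->
  {in L i, forall a, E (act a x) = E x}.
Proof. by move=> /hasPn nv a /nv; rewrite negbK => /eqP. Qed.

Arguments ladder : simpl never.
Context (U : nat).
Local Notation S := (4 * U)%N.

(* [4] times the number of maps in [h] that vary near [x], where allowing the
   larger radius [S.+1 + j] costs [j]: this makes the count [1]-Lipschitz. *)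
Definition usage (h : seq (X -> X)) x : nat :=
  \max_(j < S.+1) (4 * count (fun E => varies (L (S.+1 + j)) E x) h - j)%N.

Definition sparse (h : seq (X -> X)) :=
  forall x, (count (fun E => varies (L (S.+1 + S)) E x) h <= U)%N.

Lemma usage_ge h x j : (j <= S)%N ->
  (4 * count (fun E => varies (L (S.+1 + j)) E x) h - j <= usage h x)%N.
Proof.
rewrite -ltnS => jS; rewrite /usage.
exact: (leq_bigmax (F := fun j : 'I_S.+1 =>
  (4 * count (fun E => varies (L (S.+1 + j)) E x) h - j)%N) (Ordinal jS)).
Qed.

Lemma usage_le h x : sparse h -> (usage h x <= S)%N.
Proof.
move=> sp; apply/bigmax_leqP => j _; apply: (leq_trans (leq_subr _ _)).
rewrite leq_pmul2l //; apply: leq_trans (sp x); apply: sub_count => E; cbv beta.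
by apply: varies_le; rewrite leq_add2l -ltnS.
Qed.

(** Moving by [b] is absorbed by one more rung, that is by passing from [j] to [j.+1], which costs
    1. The last index [j = S] has no successor, but there sparsity makes the term zero. *)
Lemma usage_shift h x b : sparse h -> b \in L S.+1 ->
  (usage h (act b x) <= (usage h x).+1)%N.
Proof.
move=> sp bL; apply/bigmax_leqP => j _.
have [jS|Sj] := ltnP j S; last first.
  apply: (@leq_trans 0) => //; rewrite leqn0 subn_eq0 (leq_trans _ Sj)//.
  rewrite leq_pmul2l //; apply: leq_trans (sp (act b x)); apply: sub_count => E; cbv beta.
  by apply: varies_le; rewrite leq_add2l -ltnS.
apply: (@leq_trans (4 * count (fun E => varies (L (S.+1 + j.+1)) E x) h - j.+1).+1);
  last by rewrite ltnS; exact: usage_ge.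
have : (count (fun E => varies (L (S.+1 + j)) E (act b x)) h <=
        count (fun E => varies (L (S.+1 + j.+1)) E x) h)%N.
  apply: sub_count => E; cbv beta; rewrite addnS; apply: varies_shift.
  by apply: ladder_le bL; exact: leq_addr.
by move: (count _ _) (count _ _) => m n; lia.
Qed.

Lemma usage_unshift h x b : sparse h -> b \in L S.+1 ->
  (usage h x <= (usage h (act b x)).+1)%N.
Proof.
move=> sp bL; rewrite -{1}(act1 x) -(mulVg b) actM.
by apply: usage_shift => //; exact: ladderV.
Qed.

Lemma usage_cons E h x : (usage h x <= usage (E :: h) x)%N.
Proof.
apply/bigmax_leqP => j _; have /(usage_ge (E :: h) x) : (j <= S)%N by rewrite -ltnS.
by apply: leq_trans; apply: leq_sub2r; rewrite leq_pmul2l // leq_addl.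
Qed.

Lemma usage_varies E h x : varies (L S.+1) E x ->
  (usage h x + 4 <= usage (E :: h) x)%N.
Proof.
move=> vE.
have vEj j : varies (L (S.+1 + j)) E x by apply: varies_le vE; exact: leq_addr.
(* Subtraction is truncated, so a zero maximum may hide a negative term; in that case the index
   [j = 0] gives 4 directly. *)
have [->|n0] := eqVneq (usage h x) 0.
  apply: leq_trans (usage_ge (E :: h) x (leq0n S)).
  by rewrite /= vEj subn0; lia.
have [|j] := @eq_bigmax 'I_S.+1
  (fun j => 4 * count (fun E => varies (L (S.+1 + j)) E x) h - j)%N.
  by rewrite card_ord.
rewrite -/(usage h x) => ej.
apply: leq_trans (usage_ge (E :: h) x (_ : j <= S)%N); last by rewrite -ltnS.
move: n0; rewrite ej; set c := count _ h.
have -> : count (fun E => varies (L (S.+1 + j)) E x) (E :: h) = c.+1.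
  by rewrite /c /= vEj.
by move: c => c; clear; lia.
Qed.

Section Level.
Context (p : X -> X) (D0 : seq G) (pD : displaced D0 p).

(* [level e k] pairs the cell map after [k] modifications with the list of the
   maps [e i \o H_i] responsible for them. Near the places where [e k \o H]
   varies, the cell of [y] becomes that of a nearby point minimizing [e k \o H];
   the radius of the search shrinks with the number of modifications already
   made around [y]. *)
Fixpoint level (e : nat -> X -> X) k : (X -> X) * seq (X -> X) :=
  if k is k.+1 then
    let: (H, h) := level e k in
    (fun y => H (act (pick_min (e k \o H) (L (S - usage h y - 2)) 1 y) y),
     (e k \o H) :: h)
  else (p, [::]).

Definition refine e k : X -> X := e k \o (level e k).1.

Lemma levelS e k : level e k.+1 =
  (fun y => (level e k).1 (act (pick_min (refine e k)
     (L (S - usage (level e k).2 y - 2)) 1 y) y), refine e k :: (level e k).2).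
Proof. by rewrite /refine /=; case: (level e k). Qed.

Lemma level_ext e e' k : (forall i, (i < k)%N -> e i = e' i) ->
  level e k = level e' k.
Proof.
elim: k => // k IHk ee'; rewrite !levelS /refine ee'// IHk// => i ik.
by apply: ee'; exact: ltnW.
Qed.

Lemma refine_ext e e' k : (forall i, (i <= k)%N -> e i = e' i) ->
  refine e k = refine e' k.
Proof.
by move=> ee'; rewrite /refine ee'// (@level_ext e e')// => i ik; apply/ee'/ltnW.
Qed.

(** Bounds the displacement of a modified cell map at points of usage [v]: one factor [L S] per unit
    of usage. *)
Definition spread v : seq G := iter v (fun D => products D (L S)) D0.
(** Where [e k \o H] varies at the largest radius, [e k] varies over this set. *)
Definition reach : seq G := products (spread S) (L (S.+1 + S)).

Lemma spread_le v w : (v <= w)%N -> {subset spread v <= spread w}.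
Proof.
move=> /subnK <-; elim: (w - v)%N => // k IHk d /IHk dD.
by rewrite addSn /= -(mulg1 d) mem_products//; exact: ladder1.
Qed.

Context (e : nat -> X -> X) (N : nat).
Context (Nsparse : forall x,
  (count (fun i => varies reach (e i) x) (iota 0 N) <= U)%N).

Let budget k x : (k <= N)%N ->
  (count (fun i => varies reach (e i) x) (iota 0 k) <= U)%N.
Proof.
move=> kN; apply: leq_trans (Nsparse x).
by rewrite -(subnKC kN) iotaD count_cat leq_addr.
Qed.

(** The two claims are proved together: bounded displacement turns variation of [e k \o H] into
    variation of [e k], and the resulting sparsity bounds usage, hence displacement. *)
Lemma level_invariant k : (k <= N)%N ->
  (forall x, (count (fun E => varies (L (S.+1 + S)) E x) (level e k).2 <=
              count (fun i => varies reach (e i) x) (iota 0 k))%N) /\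
  (forall x, exists2 d, d \in spread (usage (level e k).2 x) &
                        (level e k).1 x = act d x).
Proof.
elim: k => [_|k IHk kN].
  split=> // x; have [d dD pd] := pD x; exists d => //.
  exact: (spread_le (leq0n _)) dD.
have [cnt dis] := IHk (ltnW kN).
have sp : sparse (level e k).2.
  by move=> x; apply: leq_trans (cnt x) (budget x (ltnW kN)).
have disS x : exists2 d, d \in spread S & (level e k).1 x = act d x.
  have [d dD ->] := dis x; exists d => //.
  by apply: spread_le dD; exact: usage_le.
rewrite levelS; split=> x.
  rewrite count_iotaS /= addnC leq_add//.
  case: (boolP (varies (L _) _ x)) => // /hasP[a aL].
  rewrite /refine /= => ne; rewrite lt0b; apply/hasP.
  have [d dD ex] := disS x; have [d' dD' eax] := disS (act a x).
  rewrite ex eax -actM in ne.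
  have [eq|ne'] := eqVneq (e k (act d x)) (e k x).
    by exists (d' * a); [exact: mem_products|rewrite -eq].
  exists d => //; rewrite -(mulg1 d) mem_products//; exact: ladder1.
rewrite /=.
set A := L (S - _ - 2); set b := pick_min _ _ _ _.
have [d dD ->] := dis (act b x); exists (d * b); last by rewrite actM.
have bA : b \in A.
  have := pick_min_in (refine e k) A 1 x.
  by rewrite in_cons => /orP[/eqP|//]; rewrite -/b => ->; exact: ladder1.
have bS : b \in L S.
  by apply: ladder_le bA; rewrite -subnDA leq_subr.
have [nv|v] := boolP (varies (L S.+1) (refine e k) x); last first.
  have b1 : b = 1.
    apply: pick_min_id => a aA; apply: (constant_near v).
    by apply: ladder_le aA; rewrite -subnDA (leq_trans (leq_subr _ _)).
  rewrite b1 mulg1; rewrite b1 act1 in dD.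
  by apply: spread_le dD; exact: usage_cons.
(* Moving to [act b x] raises usage by at most 1, while recording [E] raises it by at least 4 at
   [x]; this pays for the extra factor [L S]. *)
have le : ((usage (level e k).2 (act b x)).+1 <=
    usage (refine e k :: (level e k).2) x)%N.
  apply: leq_trans (usage_varies _ nv).
  have := usage_shift x sp (ladder_le (leqnSn S) bS).
  by move: (usage _ _) (usage _ _) => m n; clear; lia.
by apply: (spread_le le); rewrite /spread iterS; exact: mem_products.
Qed.

Let level_sparse k : (k <= N)%N -> sparse (level e k).2.
Proof.
move=> kN x; have [cnt _] := level_invariant kN.
exact: leq_trans (cnt x) (budget x kN).
Qed.

Lemma level_displaced k : (k <= N)%N -> displaced (spread S) (level e k).1.
Proof.
move=> kN x; have [_ /(_ x)[d dD ->]] := level_invariant kN; exists d => //.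
by apply: spread_le dD; apply: usage_le; exact: level_sparse.
Qed.

Let cells k i x : seq X := undup [seq (level e k).1 (act a x) | a <- L i].

Let mem_cells k i x a : a \in L i -> (level e k).1 (act a x) \in cells k i x.
Proof. by move=> aL; rewrite mem_undup; apply/mapP; exists a. Qed.

Let cells_le k i j x : (i <= j)%N -> (size (cells k i x) <= size (cells k j x))%N.
Proof.
move=> ij; apply: uniq_leq_size; first exact: undup_uniq.
move=> y; rewrite mem_undup => /mapP[a aL ->]; apply: mem_cells.
exact: ladder_le aL.
Qed.

Context (c : nat) (pc : forall x, (size (undup [seq p (act a x) | a <- L S]) <= c)%N).

(* If [E = e k \o H] takes values [u] below [v] near [x], no point near [x]
   minimizes to [v], so the cells of [H] over [v] are lost at the next level. *)
Lemma level_cells k x : (k <= N)%N ->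
  (size (cells k (S - usage (level e k).2 x) x) +
   count (fun E => varies B E x) (level e k).2 <= c)%N.
Proof.
elim: k x => [|k IHk] x kN.
  by rewrite addn0; apply: leq_trans (pc x); apply: cells_le; exact: leq_subr.
have {IHk} := IHk x (ltnW kN).
have sp := level_sparse (ltnW kN); have spS := level_sparse kN.
have uS := usage_le x spS.
rewrite levelS /= in uS *; rewrite -/(level e).
move: uS; set h := (level e k).2; set E := refine e k => uS IH.
(* Where [E] is constant at radius [S.+1], the search returns 1 at all points considered: no cell
   changes and [E] is not counted. *)
have [nv|v] := boolP (varies (L S.+1) E x); last first.
  have vB : varies B E x = false.
    by apply: contraNF v => /(varies_le (i := 0)); apply.
  rewrite vB add0n; apply: leq_trans IH; rewrite leq_add2r.
  apply: leq_trans (cells_le k x (leq_sub2l S (usage_cons E h x))).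
  apply: uniq_leq_size; first exact: undup_uniq.
  move=> y; rewrite mem_undup => /mapP[a aL ->]; rewrite levelS /=.
  have aS : a \in L S by apply: ladder_le aL; exact: leq_subr.
  rewrite pick_min_id; first by rewrite act1; exact: mem_cells.
  move=> b bL; rewrite -actM -/E (constant_near v) ?(constant_near v)//.
    by apply: ladder_le aS.
  apply: ladderM aS; apply: ladder_le bL.
  by rewrite -subnDA leq_subr.
have uE := usage_varies h nv; rewrite -/S.
set s := (S - usage h x)%N in IH.
have s4 : (S - usage (E :: h) x <= s - 4)%N by rewrite /s -subnDA leq_sub2l.
have s_ge4 : (4 <= s)%N by rewrite /s leq_subRL; lia.
(* Within this radius usage differs from that at [x] by at most 1, so the search radius
   [S - usage h (act a x) - 2] lies between [s - 3] and [s - 1]. *)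
have key a : a \in L (s - 4) -> exists A, [/\ {subset L (s - 3) <= A},
    {subset A <= L (s - 1)} &
    (level e k.+1).1 (act a x) =
      (level e k).1 (act (pick_min E A 1 (act a x)) (act a x))].
  move=> aL; exists (L (S - usage h (act a x) - 2)); rewrite levelS; split=> //.
    apply: ladder_le.
    have aS : a \in L S.+1 by apply: ladder_le aL; rewrite /s; lia.
    have := usage_shift x sp aS; have := usage_unshift x sp aS.
    by rewrite -/h /s; lia.
  apply: ladder_le.
  have aS : a \in L S.+1 by apply: ladder_le aL; rewrite /s; lia.
  have := usage_shift x sp aS; have := usage_unshift x sp aS.
  by rewrite -/h /s; lia.
have pick_in a A : {subset L (s - 3) <= A} -> {subset A <= L (s - 1)} ->
    a \in L (s - 4) -> pick_min E A 1 (act a x) * a \in L s.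
  move=> sA As aL; apply: (@ladderM_le (s - 1) (s - 4)); rewrite ?subn_gt0 //; try lia.
  apply: As; have := pick_min_in E A 1 (act a x).
  by rewrite in_cons => /orP[/eqP->|//]; apply: sA; exact: ladder1.
have sub : {subset cells k.+1 (S - usage (E :: h) x) x <= cells k s x}.
  move=> y; rewrite mem_undup => /mapP[a /(ladder_le s4) aL ->].
  have [A [sA As ->]] := key a aL.
  by rewrite -actM; apply: mem_cells; exact: pick_in.
have [vB|nvB] := boolP (varies B E x); last first.
  rewrite add0n; apply: leq_trans IH; rewrite leq_add2r.
  by apply: uniq_leq_size => //; exact: undup_uniq.
have [b1 [b2 [b1B b2B lt]]] : exists b1 b2, [/\ b1 \in B, b2 \in B &
    lex (E (act b1 x)) (E (act b2 x))].
  move/hasP: vB => [b bB /eqP ne]; have [lt|lt] := lex_total ne.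
    by exists b, 1; rewrite act1.
  by exists 1, b; rewrite act1.
apply: leq_trans IH; rewrite addnA leq_add2r addn1.
(* The lost cell: from any [act a x] in range the search also sees [act b1 x], whose [E]-value is
   smaller than the value [E (act b2 x)] that [y2] would give. *)
set y2 := (level e k).1 (act b2 x).
apply: (@uniq_leq_size _ (y2 :: _)); last first.
  move=> y; rewrite in_cons => /orP[/eqP->|]; last exact: sub.
  by apply: mem_cells; apply: (ladder_le (leq0n _)) b2B.
rewrite cons_uniq undup_uniq andbT; apply/negP.
rewrite mem_undup => /mapP[a /(ladder_le s4) aL].
have [A [sA _ ->]] := key a aL => y2E.
have b1A : b1 * a^-1 \in A.
  apply: sA; apply: (@ladderM_le 0 (s - 4)) => //; try lia.
  exact: ladderV.
have := pick_min_min E (act a x) (mem_behead (s := 1 :: A) b1A).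
by rewrite -actM mulgVK {2}/E /refine /= -y2E => /negP; apply; exact: lt.
Qed.

(** The inequality of [level_cells] becomes strict because at least one cell always remains. *)
Lemma level_count k x : (k <= N)%N ->
  (count (fun i => varies B (refine e i) x) (iota 0 k) < c)%N.
Proof.
move=> kN; have := level_cells x kN; apply: leq_trans.
have -> : count (fun i => varies B (refine e i) x) (iota 0 k) =
    count (fun E => varies B E x) (level e k).2.
  elim: k {kN} => // k IHk.
  by rewrite levelS count_iotaS /= IHk addnC.
rewrite -addn1 addnC leq_add2r lt0n size_eq0; apply/eqP => c0.
by have := mem_cells k x (ladder1 (S - usage (level e k).2 x)); rewrite c0.
Qed.

End Level.

Lemma locally_constant_varies A E : piecewise E -> locally_constant (varies A E).
Proof.
move=> pE x; elim: A => [|a A IHA]; first by near=> y.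
have ax := locally_constant_eq (piecewise_act a pE) pE x.
near=> y; rewrite /varies /=; congr (~~ _ || _); near: y; [exact: ax|exact: IHA].
Unshelve. all: by end_near.
Qed.

Lemma locally_constant_usage h : {in h, forall E, piecewise E} ->
  locally_constant (usage h).
Proof.
move=> ph x.
have cnt j : \forall y \near x, count (fun E => varies (L (S.+1 + j)) E y) h =
    count (fun E => varies (L (S.+1 + j)) E x) h.
  elim: h ph => [|E h IHh] ph; first by near=> y.
  have pE : piecewise E by apply: ph; exact: mem_head.
  near=> y; rewrite /=; congr (nat_of_bool _ + _)%N; near: y.
    exact: locally_constant_varies.
  by apply: IHh => F Fh; apply: ph; rewrite in_cons Fh orbT.
have cnts m : \forall y \near x, forall j, (j < m)%N ->
    count (fun E => varies (L (S.+1 + j)) E y) h =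
    count (fun E => varies (L (S.+1 + j)) E x) h.
  elim: m => [|m IHm]; first by near=> y.
  near=> y => j; rewrite ltnS leq_eqVlt => /orP[/eqP ->|].
    by near: y; exact: cnt.
  by move: j; near: y; exact: IHm.
near=> y; apply: eq_bigr => j _; congr (4 * _ - _)%N.
move: (ltn_ord j); move: (nat_of_ord j); near: y; exact: cnts.
Unshelve. all: by end_near.
Qed.

Section PiecewiseLevels.
Context (p : X -> X) (pp : piecewise p) (e : nat -> X -> X).
Context (pe : forall k, piecewise (e k)).

Lemma level_piecewise k : piecewise (level p e k).1 /\
  {in (level p e k).2, forall E, piecewise E}.
Proof.
elim: k => [//|k [pH ph]]; rewrite levelS.
have pE : piecewise (refine p e k) by exact: piecewise_comp.
split=> [|E] /=; last first.
  by rewrite in_cons => /orP[/eqP->//|]; exact: ph.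
apply: (piecewise_comp pH); apply: piecewise_locally_constant => x.
near=> y; have -> : usage (level p e k).2 y = usage (level p e k).2 x.
  by near: y; exact: locally_constant_usage.
by near: y; exact: pick_min_loc.
Unshelve. all: by end_near.
Qed.

Lemma refine_piecewise k : piecewise (refine p e k).
Proof. by apply: piecewise_comp => //; have [] := level_piecewise k. Qed.

End PiecewiseLevels.
End Ladder.

Lemma displaced_comp D D' f h : displaced D f -> displaced D' h ->
  displaced (products D D') (f \o h).
Proof.
move=> fD hD x; have [d' dD' hx] := hD x; have [d dD fx] := fD (h x).
by exists (d * d'); [exact: mem_products|rewrite /= fx hx actM].
Qed.

(** * Markers *)

Section Markers.
Context (D : seq G) (D1 : 1 \in D) (DV : {in D, forall d, d^-1 \in D}).

Let good n := `[< forall x, bit n x ->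
  {in D, forall d, bit n (act d x) -> d = 1} >].

(** By freeness, [x] and [act d x] differ in some bit when [d] is not 1. Intersecting over the
    finite [D] gives a neighbourhood disjoint from its nontrivial [D]-translates. *)
Let good_cover x : exists n, good n /\ bit n x.
Proof.
have nbr d : exists V : set X, nbhs x V /\ forall y, V y -> V (act d y) -> d = 1.
  have [->|d1] := eqVneq d 1; first by exists setT; split=> //; exact: filterT.
  have ne : act d x <> x by move=> /free; apply/eqP.
  have [m [_ dm]] := first_difference ne.
  exists [set y | bit m (act d y) = bit m (act d x) /\ bit m y = bit m x].
  split.
    apply: filterI; last exact: bit_loc.
    exact: (near_act (bit_loc m (act d x))).
  by move=> y [yd _] [_ ydx]; rewrite -yd ydx eqxx in dm.
have [V [Vx VD]] : exists V : set X, nbhs x V /\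
    forall y, V y -> {in D, forall d, V (act d y) -> d = 1}.
  elim: (D) => [|d s [V [Vx Vs]]]; first by exists setT; split=> //; exact: filterT.
  have [W [Wx Wd]] := nbr d.
  exists (V `&` W); split; first exact: filterI.
  move=> y [Vy Wy] c; rewrite in_cons => /orP[/eqP-> [_]|cs [Vc _]].
    exact: Wd.
  exact: Vs Vc.
have [n [nx nV]] := bit_basis Vx; exists n; split=> //; apply/asboolP.
by move=> y /nV Vy d dD /nV; exact: VD.
Qed.

(** Greedy construction of a maximal discrete set: stage [n.+1] adds the points of the [n]-th set,
    if good, that have no marked [D]-translate yet. *)
Fixpoint mark n x : bool :=
  if n is n.+1 then
    mark n x || [&& good n, bit n x & ~~ has (fun d => mark n (act d x)) D]
  else false.

Definition marked x := `[< exists n, mark n x >].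

Let mark_le m n x : (m <= n)%N -> mark m x -> mark n x.
Proof.
by move=> /subnK <-; elim: (n - m)%N => // k IHk /IHk; rewrite addSn /= => ->.
Qed.

(** A point of a good set left unmarked at the stage of that set has a marked translate, which
    blocks it at all later stages. Hence finitely many stages decide the marking locally. *)
Let markedE n x : good n -> bit n x -> marked x = mark n.+1 x.
Proof.
move=> gn nx; apply/asboolP/idP => [[m]|]; last by exists n.+1.
elim: m => [//|m IHm] /=; case/orP => // /and3P[gm mx /hasPn nm].
have [mn|nm'] := ltnP m n.
  apply/orP; left; apply: (mark_le mn); rewrite /= gm mx.
  by apply/orP; right; apply/hasPn.
rewrite gn nx /=; case: (boolP (mark n x)) => //= _; apply/hasPn => d dD.
by apply: contra (nm d dD); exact: mark_le.
Qed.

Lemma marked_locally_constant : locally_constant marked.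
Proof.
have markl n : locally_constant (mark n).
  elim: n => [|n IHn] x; first by near=> y.
  have hl : \forall y \near x, has (fun d => mark n (act d y)) D =
      has (fun d => mark n (act d x)) D.
    elim: (D) => [|d s IHs]; first by near=> y.
    near=> y; rewrite /=; congr (_ || _); near: y; last exact: IHs.
    exact: near_act (IHn _).
  near=> y; rewrite /=; congr (_ || [&& _, _ & ~~ _]); near: y;
    [exact: IHn|exact: bit_loc|exact: hl].
move=> x; have [n [gn nx]] := good_cover x.
have ny := bit_loc n x.
near=> y; have yn : bit n y = bit n x by near: y; exact: ny.
by rewrite !(markedE gn) ?yn//; near: y; exact: markl.
Unshelve. all: by end_near.
Qed.

Lemma marked_cover x : exists2 d, d \in D & marked (act d x).
Proof.
have [n [gn nx]] := good_cover x.
case: (boolP (has (fun d => mark n (act d x)) D)) => [/hasP[d dD dm]|nh].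
  by exists d => //; apply/asboolP; exists n.
exists 1 => //; rewrite act1; apply/asboolP; exists n.+1.
by rewrite /= gn nx nh orbT.
Qed.

(** If one point enters later, the earlier one would have blocked it, by symmetry of [D] in either
    direction; if both enter together, goodness of the set gives [d = 1]. *)
Lemma marked_discrete x d : d \in D -> marked x -> marked (act d x) -> d = 1.
Proof.
move=> dD /asboolP[m mx] /asboolP[n nx].
have := mark_le (leq_maxl m n) mx; have := mark_le (leq_maxr m n) nx.
elim: (maxn m n) => // k IHk /= /orP[dk|/and3P[gk bdk /hasPn ndk]]
  /orP[xk|/and3P[_ bk /hasPn nk]].
- exact: IHk.
- by rewrite (negbTE (nk _ dD)) in dk.
- by have := ndk _ (DV dD); rewrite -actM mulVg act1 xk.
- by have /asboolP gkP := gk; exact: gkP bk _ dD bdk.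
Qed.

End Markers.

(** With [D = Q^-1 Q], discreteness makes the points [act q m], for [q] in [Q] and [m] a value of
    [p] on [A x], pairwise distinct. They all lie in [Q Q^-1 Q A x], so the number of values times
    [size Q] is at most [size R]. *)
Lemma marker_map K c (A : seq G) : subgroup K -> tiles K [set 1] c ->
  {in A, forall a, K a} ->
  exists (p : X -> X) (D : seq G), [/\ piecewise p, displaced D p,
    {in D, forall d, K d} &
    forall x, (size (undup [seq p (act a x) | a <- A]) <= c)%N].
Proof.
move=> [K1 KM KV] tl KA; have [Q [R [Qn KQ [uQ _] cov sz]]] := tl A KA.
pose D := [seq q^-1 * r | q <- Q, r <- Q].
have D1 : 1 \in D.
  case: (Q) @D Qn => // q s D _; rewrite -(mulVg q).
  by apply/allpairsP; exists (q, q); rewrite !mem_head.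
have DV : {in D, forall d, d^-1 \in D}.
  move=> d /allpairsP[[q r] /= [qQ rQ ->]]; rewrite invgM invgK.
  by apply/allpairsP; exists (r, q).
pose f x := nth 1 D (find (fun d => marked D (act d x)) D).
have fD x : f x \in D.
  rewrite mem_nth// -has_find; have [d dD md] := marked_cover D1 x.
  by apply/hasP; exists d.
have fm x : marked D (act (f x) x).
  apply: (@nth_find _ 1 (fun d => marked D (act d x))).
  by have [d dD md] := marked_cover D1 x; apply/hasP; exists d.
exists (fun x => act (f x) x), D; split.
- apply: piecewise_locally_constant => x; rewrite /f.
  have findl s : \forall y \near x, find (fun d => marked D (act d y)) s =
      find (fun d => marked D (act d x)) s.
    elim: s => [|d s IHs]; first by near=> y.
    have dx := near_act (@marked_locally_constant D (act d x)).
    near=> y; rewrite /=; have -> : marked D (act d y) = marked D (act d x) by near: y.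
    by congr (if _ then _ else _.+1); near: y; exact: IHs.
  by apply: filterS (findl D) => y ->.
- by move=> x; exists (f x).
- move=> d /allpairsP[[q r] /= [qQ rQ ->]].
  by apply: KM; [apply: KV|]; exact: KQ.
- move=> x; set s := undup _.
  have Q0 : (0 < size Q)%N by case: (Q) Qn.
  rewrite -(leq_pmul2r Q0); apply: leq_trans sz.
  have sP m : m \in s -> exists d a,
      [/\ d \in D, a \in A, m = act d (act a x) & marked D m].
    rewrite mem_undup => /mapP[a aA ->]; exists (f (act a x)), a.
    by split=> //; exact: fm.
  rewrite mulnC -(size_allpairs act) -(size_map (act^~ x) R).
  apply: uniq_leq_size.
    apply: allpairs_uniq => //; first exact: undup_uniq.
    move=> [? ?] [? ?] /allpairsP[[q m] /= [qQ ms [-> ->]]].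
    move=> /allpairsP[[q' m'] /= [qQ' ms' [-> ->]]] /= eq.
    have [_ [_ [_ _ _ mm]]] := sP _ ms; have [_ [_ [_ _ _ mm']]] := sP _ ms'.
    have m'E : m' = act (q'^-1 * q) m by rewrite actM eq -actM mulVg act1.
    have : q'^-1 * q = 1.
      apply: (@marked_discrete D DV m) => //; last by rewrite -m'E.
      by apply/allpairsP; exists (q', q).
    by move=> e; rewrite m'E e act1; move: e => /mulg1_eq; rewrite invgK => ->.
  move=> y /allpairsP[[q m] /= [qQ /sP[d [a [dD aA -> _]]] ->]].
  move: dD => /allpairsP[[p q'] /= [pQ qQ' ->]].
  have [r rR] := cov q p qQ pQ q' a qQ' aA.
  rewrite /cong /= => /mulg1_eq; rewrite invgK => rE.
  by apply/mapP; exists r => //; rewrite rE !actM.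
Unshelve. all: by end_near.
Qed.

(** * Combining the scales *)

Section Chain.
Context (F : nat -> seq G) (F_le : forall l, {subset F l <= F l.+1}).
Context (F_all : forall g, exists l, g \in F l).
Context (c : nat -> nat).
Context (pf : nat -> seq G -> X -> X) (df : nat -> seq G -> seq G).
Local Notation K l := (generated (F l)).
Context (pfP : forall l A, {in A, forall a, K l a} ->
  [/\ piecewise (pf l A), displaced (df l A) (pf l A),
      {in df l A, forall d, K l d} &
      forall x, (size (undup [seq pf l A (act a x) | a <- A]) <= c l)%N]).

Definition symmetrize (A : seq G) := 1 :: A ++ [seq a^-1 | a <- A].

Lemma symmetrize1 A : 1 \in symmetrize A. Proof. exact: mem_head. Qed.

Lemma symmetrizeV A : {in symmetrize A, forall a, a^-1 \in symmetrize A}.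
Proof.
move=> a; rewrite !in_cons !mem_cat => /or3P[/eqP->|aA|/mapP[b bA ->]].
- by rewrite invg1 eqxx.
- by rewrite (map_f _ aA) !orbT.
- by rewrite invgK bA orbT.
Qed.

Lemma sub_symmetrize A : {subset A <= symmetrize A}.
Proof. by move=> a aA; rewrite in_cons mem_cat aA orbT. Qed.

Lemma symmetrize_sub N A : subgroup N -> {in A, forall a, N a} ->
  {in symmetrize A, forall a, N a}.
Proof.
move=> [N1 NM NV] AN a; rewrite !in_cons mem_cat => /or3P[/eqP->//|/AN//|].
by move=> /mapP[b /AN Nb ->]; exact: NV.
Qed.

(* The scales [B] of level [l], and the set [W] bounding the displacement of
   the composite of all levels below [l]. *)
Fixpoint scales l : seq G * seq G :=
  if l is l.+1 then
    let: (B, W) := scales l in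
    let U := c l.+1 in
    let D := df l (ladder B (4 * U)) in
    let W' := products (spread B U D (4 * U)) W in
    (symmetrize (reach B U D ++ products W' (1 :: F l.+1)), W')
  else (symmetrize [::], [:: 1]).

Local Notation B l := (scales l).1.
Local Notation W l := (scales l).2.
Local Notation U l := (c l.+1).
Local Notation P l := (ladder (B l) (4 * U l)).
Local Notation D l := (df l (P l)).

Lemma scalesS l : scales l.+1 =
  (symmetrize (reach (B l) (U l) (D l) ++
     products (products (spread (B l) (U l) (D l) (4 * U l)) (W l)) (1 :: F l.+1)),
   products (spread (B l) (U l) (D l) (4 * U l)) (W l)).
Proof. by rewrite /=; case: (scales l). Qed.

Lemma scales1 l : 1 \in B l.
Proof. by case: l => [|l]; rewrite ?scalesS; exact: symmetrize1. Qed.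

Lemma scalesV l : {in B l, forall b, b^-1 \in B l}.
Proof. by case: l => [|l]; rewrite ?scalesS; exact: symmetrizeV. Qed.

Lemma products_sub N A A' : subgroup N -> {in A, forall a, N a} ->
  {in A', forall a, N a} -> {in products A A', forall a, N a}.
Proof.
move=> [_ NM _] AN AN' a /allpairsP[[b b'] /= [/AN Nb /AN' Nb' ->]].
exact: NM.
Qed.

Lemma generatedS l x : K l x -> K l.+1 x.
Proof. exact: generated_mono. Qed.

Lemma scales_sub l : {in B l, forall b, K l b} /\ {in W l, forall w, K l w}.
Proof.
have gK i := @generated_subgroup G (F i).
elim: l => [|l [IHB IHW]].
  have [K1 _ _] := gK 0.
  by split=> [|w]; [exact: symmetrize_sub|rewrite inE => /eqP ->].
have PK : {in P l, forall a, K l a} by exact: ladder_sub.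
have [_ _ DK _] := pfP PK.
have SK v : {in spread (B l) (U l) (D l) v, forall d, K l d}.
  by elim: v => [//|v IHv]; apply: products_sub => //; exact: PK.
have WK : {in products (spread (B l) (U l) (D l) (4 * U l)) (W l), forall w, K l.+1 w}.
  by move=> w /(products_sub (gK l) (@SK _) IHW); exact: generatedS.
rewrite scalesS; split=> //.
apply: symmetrize_sub => // b; rewrite mem_cat => /orP[|].
  move=> bR; apply: generatedS.
  apply: (products_sub (gK l) (@SK (4 * U l)%N) _ bR); exact: ladder_sub.
apply: products_sub => // g; rewrite in_cons => /orP[/eqP->|gF].
  by have [] := gK l.+1.
exact: gen_in.
Qed.

Let PK l : {in P l, forall a, K l a}.
Proof. by apply: ladder_sub; [exact: generated_subgroup|have [] := scales_sub l]. Qed.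

Definition base l : X -> X := pf l (P l).

(* [chain f l] is the sequence of maps seen at level [l], truncated to its
   first [f] terms. *)
Fixpoint chain f l : nat -> X -> X :=
  if f is f.+1 then
    fun k => if k is k.+1 then refine (B l) (U l) (base l) (chain f l.+1) k
             else base l
  else fun=> id.

Lemma varies_sub (A A' : seq G) E x : {subset A <= A'} -> varies A E x -> varies A' E x.
Proof. by move=> sA /hasP[a aA ne]; apply/hasP; exists a => //; exact: sA. Qed.

Let reach_sub l : {subset reach (B l) (U l) (D l) <= B l.+1}.
Proof. by move=> r rR; rewrite scalesS; apply: sub_symmetrize; rewrite mem_cat rR. Qed.

(** The bound [c l.+1] at the next level is the sparsity required at level [l], since [B l.+1]
    contains [reach]. The strict bound of [level_count] leaves room for the extra first term
    [base l]. *)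
Lemma chain_count f l x :
  (count (fun k => varies (B l) (chain f l k) x) (iota 0 f) <= c l)%N.
Proof.
elim: f l x => // f IHf l x; have [_ pD _ pc] := pfP (@PK l).
have sparse_next y :
    (count (fun i => varies (reach (B l) (U l) (D l)) (chain f l.+1 i) y)
       (iota 0 f) <= U l)%N.
  apply: leq_trans (IHf l.+1 y); apply: sub_count => i.
  exact/varies_sub/reach_sub.
have := level_count (scales1 l) (@scalesV l) pD sparse_next pc x (leqnn f).
rewrite -[iota 0 f.+1]/(0 :: iota (1 + 0) f) iotaDl /= count_map => lc.
by apply: leq_trans lc; exact: (leq_add (leq_b1 _) (leqnn _)).
Qed.

Let chain_sparse f l y :
  (count (fun i => varies (reach (B l) (U l) (D l)) (chain f l.+1 i) y)
    (iota 0 f) <= U l)%N.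
Proof.
apply: leq_trans (chain_count f l.+1 y); apply: sub_count => i.
exact/varies_sub/reach_sub.
Qed.

Lemma chain_ext f f' l k : (k < f)%N -> (k < f')%N -> chain f l k = chain f' l k.
Proof.
elim: f f' l k => [//|f IHf] [//|f'] l [//|k] kf kf' /=.
by apply: refine_ext => i ik; apply: IHf; exact: leq_ltn_trans ik _.
Qed.

(** A late map of the sequence at level 0 factors through the sequence at level [l]; [h] collects
    the modified cell maps of the levels below [l]. *)
Lemma chain_tail l f k : (k < f)%N ->
  exists2 h, displaced (W l) h & chain (l + f) 0 (l + k) =1 chain f l k \o h.
Proof.
elim: l f k => [|l IHl] f k kf.
  by exists id => // x; exists 1; rewrite ?mem_head ?act1.
have [h hW eh] := IHl f.+1 k.+1 kf.
have [_ pD _ _] := pfP (@PK l).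
exists ((level (B l) (U l) (base l) (chain f l.+1) k).1 \o h).
  rewrite scalesS; apply: displaced_comp => //.
  exact: (level_displaced (scales1 l) pD (chain_sparse f l) (ltnW kf)).
by move=> x; rewrite !addSnnS eh.
Qed.

Lemma chain_piecewise f l k : piecewise (chain f l k).
Proof.
elim: f l k => [|f IHf] l [|k] /=; try exact: piecewise_id.
  by have [] := pfP (@PK l).
by apply: refine_piecewise => //; have [] := pfP (@PK l).
Qed.

Lemma chain_displaced f l k : (k < f)%N -> exists A, displaced A (chain f l k).
Proof.
elim: f l k => [//|f IHf] l [|k] kf /=.
  by have [_ pD _ _] := pfP (@PK l); exists (D l).
have [_ pD _ _] := pfP (@PK l); have [A eA] := IHf l.+1 k kf.
exists (products A (spread (B l) (U l) (D l) (4 * U l))); apply: displaced_comp => //.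
exact: (level_displaced (scales1 l) pD (chain_sparse f l) (ltnW kf)).
Qed.

Lemma sub_in_count (T : eqType) (a b : pred T) s :
  {in s, forall x, a x -> b x} -> (count a s <= count b s)%N.
Proof.
elim: s => //= x s IHs ab; apply: leq_add; last first.
  by apply: IHs => y ys; apply: ab; rewrite in_cons ys orbT.
by have := ab x (mem_head _ _); case: (a x) => // /(_ isT) ->.
Qed.

Lemma eventually_false (Q : pred nat) m :
  (forall f, (count Q (iota 0 f) <= m)%N) -> exists n, forall k, (n <= k)%N -> ~~ Q k.
Proof.
move=> bd; apply: contrapT => /forallNP H.
have big j : exists f, (j <= count Q (iota 0 f))%N.
  elim: j => [|j [f jf]]; first by exists 0.
  have /existsNP[k /not_implyP[fk /negP]] := H f; rewrite negbK => Qk.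
  exists k.+1; rewrite count_iotaS Qk addn1 ltnS (leq_trans jf)//.
  by rewrite -(subnKC fk) iotaD count_cat leq_addr.
by have [f] := big m.+1; rewrite ltnNge bd.
Qed.

Lemma F_mono l l' : (l <= l')%N -> {subset F l <= F l'}.
Proof. by move=> /subnK <-; elim: (l' - l)%N => // k IHk g /IHk /F_le. Qed.

Lemma asymptotically_invariant : exists z : nat -> X -> X,
  [/\ forall n, piecewise (z n), forall n, exists A, displaced A (z n) &
      forall x g, exists n, forall m, (n <= m)%N -> z m (act g x) = z m x].
Proof.
exists (fun n => chain n.+1 0 n); split=> [n|n|x g]; first exact: chain_piecewise.
  exact: chain_displaced.
(* The successor is taken because [B l] contains the products of [W l] with [F l] only for positive
   [l]. *)
have [l0 gl0] := F_all g; pose l := l0.+1.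
have [|n Qn] := @eventually_false
  (fun k => chain (l + k).+1 0 (l + k) (act g x) != chain (l + k).+1 0 (l + k) x) (c l).
  move=> f; apply: leq_trans (chain_count f l x).
  apply: sub_in_count => k; rewrite mem_iota add0n => /andP[_ kf]; cbv beta.
  rewrite (@chain_ext _ (l + f)) ?ltn_add2l//.
  have [h hW eh] := chain_tail l kf; rewrite !eh /=.
  have [w wW ->] := hW x; have [w' wW' ->] := hW (act g x).
  have inB v : v \in W l -> forall u, u \in 1 :: F l -> v * u \in B l.
    move=> vW u uF; move: vW uF; rewrite /l scalesS => vW uF; apply: sub_symmetrize.
    by rewrite mem_cat; apply/orP; right; exact: mem_products.
  (* If the values at [x] and [act g x] differ, the [k]-th map of level [l] varies over [B l] at
     [x], through [w] or [w' * g]; [chain_count] allows this for at most [c l] indices. *)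
  rewrite -actM => ne; apply/hasP.
  have [eq|ne'] := eqVneq (chain f l k (act w x)) (chain f l k x).
    exists (w' * g); last by rewrite -eq.
    by apply: inB => //; rewrite in_cons (F_mono (leqnSn l0)) ?orbT.
  by exists w => //; rewrite -(mulg1 w); apply: inB; rewrite ?mem_head.
exists (l + n)%N => m lm; have := Qn (m - l)%N.
rewrite subnKC ?(leq_trans (leq_addr n l))// leq_subRL ?(leq_trans (leq_addr n l))//.
by move=> /(_ lm); rewrite negbK => /eqP.
Qed.

End Chain.

(** * Coding *)

Section Coding.
Context (num : G -> nat) (num_inj : injective num).
Context (z : nat -> X -> X) (A : nat -> seq G).
Context (z0 : forall x, z 0 x = x) (zp : forall n, piecewise (z n)).
Context (zA : forall n, displaced (A n) (z n)).
Context (zinv : forall x g, exists n, forall m, (n <= m)%N -> z m (act g x) = z m x).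

(* The letter [[:: n; j]] says that the element with number [j] moves [z n x] to
   [z n.+1 x]; the letter [[:: n; i; j]] records the [i]-th bit of the translate
   of [z n x] by the element with number [j]. *)
Definition letter x (s : seq nat) : bool :=
  match s with
  | [:: n; j] => `[< exists2 h, num h = j & z n.+1 x = act h (z n x) >]
  | [:: n; i; j] => `[< exists h, [/\ num h = j, h^-1 \in A n, (i <= n)%N &
                                     bit i (act h (z n x))] >]
  | _ => false
  end.

Lemma letter_step x n h : letter x [:: n; num h] = (z n.+1 x == act h (z n x)).
Proof.
apply/asboolP/eqP => [[h' /num_inj -> //]|e]; by exists h.
Qed.

Lemma letter_bit x n i h : letter x [:: n; i; num h] =
  [&& h^-1 \in A n, (i <= n)%N & bit i (act h (z n x))].
Proof.
apply/asboolP/and3P => [[h' [/num_inj -> //]]|[hA i_n b]]; by exists h.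
Qed.

Lemma letter_locally_constant s : locally_constant (letter ^~ s).
Proof.
case: s => [|n [|j [|k [|? ?]]]] x; try by near=> y.
  have [[h <-]|nh] := pselect (exists h, num h = j).
    have pz : piecewise (fun x => act h (z n x)).
      by apply: (@piecewise_comp (act h)) => // y; exists h; near=> w.
    near=> y; rewrite !letter_step; near: y; exact: locally_constant_eq.
  near=> y; suff E w : letter w [:: n; j] = false by rewrite !E.
  by apply/asboolP => -[h hj _]; apply: nh; exists h.
have [[h <-]|nh] := pselect (exists h, num h = k).
  have pz : piecewise (fun x => act h (z n x)).
    by apply: (@piecewise_comp (act h)) => // y; exists h; near=> w.
  near=> y; rewrite !letter_bit; congr [&& _, _ & _]; near: y.
  exact: (locally_constant_comp pz (bit_loc j)).
near=> y; suff E w : letter w [:: n; j; k] = false by rewrite !E.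
by apply/asboolP => -[h [hj _ _ _]]; apply: nh; exists h.
Unshelve. all: by end_near.
Qed.

Lemma step_exists x n : exists h, z n.+1 x = act h (z n x).
Proof.
have [a _ ->] := zA n.+1 x; have [b _ ->] := zA n x.
by exists (a * b^-1); rewrite actM -(actM b^-1) mulVg act1.
Qed.

(** Freeness leaves one step letter per stage, and the recorded bits range over [i <= n] and the
    finite [A n]. Early stages thus affect finitely many coordinates of the code. *)
Lemma finitely_many_letters x n : exists S : seq (seq nat),
  forall s, letter x (n :: s) -> n :: s \in S.
Proof.
have [a za] := step_exists x n.
exists ([:: n; num a] :: [seq [:: n; i; num h^-1] | i <- iota 0 n.+1, h <- A n]).
case=> [//|j [|k [|? ?]]] //.
  move=> /asboolP[h <- e]; rewrite (_ : h = a) ?mem_head//.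
  by apply: (@act_free _ _ (z n x)); rewrite -e -za.
move=> /asboolP[h [<- hA jn _]]; rewrite in_cons; apply/orP; right.
apply/allpairsP; exists (j, h^-1); split; [|by []|by rewrite invgK].
by rewrite mem_iota leq0n add0n ltnS.
Qed.

Definition code x : cantor_space := fun m => letter x (CodeSeq.decode m).

Lemma code_continuous : continuous code.
Proof.
move=> x; apply/cvg_sup => m V [V'] [[W] oW <-] WfN WV.
apply: (filterS WV); rewrite nbhs_simpl.
apply: filterS (letter_locally_constant (CodeSeq.decode m) x) => y e.
by move: WfN; rewrite /= /proj /code e.
Qed.

Lemma orbit_code x g : E0 (code x) (code (act g x)).
Proof.
have [N zN] := zinv x g.
have [S SP] : exists S : seq (seq nat), forall n s, (n < N)%N ->
    letter x (n :: s) || letter (act g x) (n :: s) -> n :: s \in S.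
  elim: N {zN} => [|N [S SP]]; first by exists [::].
  have [Sx Px] := finitely_many_letters x N.
  have [Sy Py] := finitely_many_letters (act g x) N.
  exists (Sx ++ Sy ++ S) => n s; rewrite ltnS leq_eqVlt => /orP[/eqP->|nN].
    by move=> /orP[/Px|/Py] sS; rewrite !mem_cat sS ?orbT.
  by move=> /(SP _ _ nN) sS; rewrite !mem_cat sS !orbT.
exists (\max_(s <- S) CodeSeq.code s).+1 => m Sm; rewrite /code.
move: (CodeSeq.decodeK m); case: (CodeSeq.decode m) => [//|n s] dm.
have [nN|Nn] := ltnP n N.
  have : n :: s \notin S.
    apply: contraL Sm => sS; rewrite -ltnNge ltnS -dm.
    exact: (@leq_bigmax_seq _ _ xpredT CodeSeq.code).
  by move=> /(contra (SP n s nN)) /norP[/negbTE -> /negbTE ->].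
have e i : (N <= i)%N -> z i (act g x) = z i x := zN i.
case: s {dm} => [//|j [|k [|? ?]]] //=; rewrite !e// (leq_trans Nn)//.
Qed.

(** Agreement of the codes from [N] on forces the two sequences [z n] to move by the same elements;
    the recorded bits then identify the two points up to the fixed factor [k * h^-1]. *)
Lemma code_orbit x y N : (forall m, (N <= m)%N -> code x m = code y m) ->
  forall h k, x = act h (z N x) -> y = act k (z N y) -> y = act (k * h^-1) x.
Proof.
move=> eqc h k xh yk.
have eql n s : (N <= n)%N -> letter x (n :: s) = letter y (n :: s).
  move=> Nn; have := eqc (CodeSeq.code (n :: s)); rewrite /code CodeSeq.codeK; apply.
  (* A code exceeds each of its entries, so every letter of stage [n >= N] sits at a position past
     [N]. *)
  apply: leq_trans Nn _; apply: ltnW.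
  by have /allP/(_ n) := CodeSeq.ltn_code (n :: s); apply; exact: mem_head.
have pos n : exists h' k', [/\ x = act h' (z (N + n) x),
    y = act k' (z (N + n) y) & k' * h'^-1 = k * h^-1].
  elim: n => [|n [h' [k' [xh' yk' e]]]]; first by exists h, k; rewrite addn0.
  have [a za] := step_exists x (N + n).
  have zay : z (N + n).+1 y = act a (z (N + n) y).
    by apply/eqP; rewrite -letter_step -eql ?leq_addr// letter_step za.
  exists (h' * a^-1), (k' * a^-1); rewrite addnS za zay -!actM !mulgVK; split=> //.
  by rewrite invgM invgK -mulgA mulKg.
(* Stage [N + i] records bit [i]. Translating by [k'] turns [z (N + i) y] into [y] and [z (N + i) x]
   into [act (k * h^-1) x]. *)
apply: bit_sep => i.
have [h' [k' [xh' yk' e]]] := pos i.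
have k'A : k'^-1 \in A (N + i).
  have [d dA zd] := zA (N + i) y.
  rewrite (_ : k'^-1 = d)//; apply: mulg1_eq.
  by apply: (@free _ y); rewrite actM -zd -yk'.
have := eql (N + i)%N [:: i; num k'] (leq_addr _ _).
rewrite !letter_bit k'A leq_addl -yk' /= => <-; congr bit.
by rewrite -e actM {2}xh' -(actM h'^-1) mulVg act1.
Qed.

Lemma coding : exists f : X -> cantor_space,
  [/\ continuous f, injective f &
      forall x y, (exists g, act g x = y) <-> E0 (f x) (f y)].
Proof.
exists code; split; first exact: code_continuous.
  (* Equal codes agree from stage 0, where [z 0] is the identity, so both starting elements are
     1. *)
  move=> x y e; have := @code_orbit x y 0 _ 1 1.
  by rewrite !z0 !act1 invg1 mulg1 act1 => ->//; rewrite ?e.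
move=> x y; split=> [[g <-]|[N eN]]; first exact: orbit_code.
have [a _ za] := zA N x; have [b _ zb] := zA N y.
exists (b^-1 * a^-1^-1); apply/esym/(code_orbit eN).
  by rewrite za -actM mulVg act1.
by rewrite zb -actM mulVg act1.
Qed.

End Coding.

Lemma locally_nilpotent_coding (num : G -> nat) : injective num ->
  locally_nilpotent *%g 1 (fun x : G => x^-1) ->
  exists f : X -> cantor_space, [/\ continuous f, injective f &
      forall x y, (exists g, act g x = y) <-> E0 (f x) (f y)].
Proof.
move=> num_inj ln.
have ex_e n : exists o : option G, forall g, num g = n -> o = Some g.
  have [[g gn]|ng] := pselect (exists g, num g = n).
    by exists (Some g) => h; rewrite -gn => /num_inj ->.
  by exists None => g gn; case: ng; exists g.
have [e eP] := choice ex_e.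
pose F l := pmap e (iota 0 l).
have FP l g : (num g < l)%N -> g \in F l.
  move=> gl; rewrite mem_pmap; apply/mapP; exists (num g).
    by rewrite mem_iota leq0n.
  by rewrite (eP _ g).
have F_le l : {subset F l <= F l.+1}.
  by move=> g; rewrite /F -addn1 iotaD pmap_cat mem_cat => ->.
have F_all g : exists l, g \in F l by exists (num g).+1; exact: FP.
have ex_c l : exists c, tiles (generated (F l)) [set 1] c.
  by apply: nilpotent_tiles; apply: ln; exact: finite_seq.
have [c cP] := choice ex_c.
have ex_m (q : nat * seq G) : exists r : (X -> X) * seq G,
    {in q.2, forall a, generated (F q.1) a} ->
    [/\ piecewise r.1, displaced r.2 r.1,
        {in r.2, forall d, generated (F q.1) d} &
        forall x, (size (undup [seq r.1 (act a x) | a <- q.2]) <= c q.1)%N].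
  have [qK|] := pselect {in q.2, forall a, generated (F q.1) a}; last first.
    by exists (id, [::]).
  have [p [D [pp pD DK pc]]] := marker_map (generated_subgroup _) (cP q.1) qK.
  by exists (p, D).
have [m mP] := choice ex_m.
have [z [zp zA zinv]] := @asymptotically_invariant F F_le F_all c
  (fun l A => (m (l, A)).1) (fun l A => (m (l, A)).2) (fun l A => mP (l, A)).
have [A AP] := choice zA.
(* The identity is put in front as stage 0, as injectivity of the coding requires. *)
apply: (coding num_inj (z := fun n => if n is n.+1 then z n else id)
  (A := fun n => if n is n.+1 then A n else [:: 1])) => //.
- by case=> [|n]; [exact: piecewise_id|].
- by case=> [|n] // x; exists 1; rewrite ?mem_head ?act1.
- by move=> x g; have [n zn] := zinv x g; exists n.+1 => -[//|k]; exact: zn.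
Qed.

End Action.

(** * Countable clopen bases of zero-dimensional Polish spaces *)

Section Bits.
Context (X : topologicalType).

Lemma open_ball (d : X -> X -> R) (x : X) (r : R) : is_metric d ->
  metric_compatible d -> open [set y | Rlt (d x y) r].
Proof.
move=> [_ _ _ dtri] dopen; apply/dopen => y /= xy.
exists (Rminus r (d x y)); split; first by Lra.lra.
by move=> z /= yz; have := dtri x y z; Lra.lra.
Qed.

Lemma nbhs_ball (d : X -> X -> R) (x : X) (r : R) : is_metric d ->
  metric_compatible d -> Rlt R0 r -> nbhs x [set y | Rlt (d x y) r].
Proof.
move=> dm dopen r0; apply: open_nbhs_nbhs; split; first exact: open_ball.
by case: dm => _ d0 _ _; rewrite /= (d0 x x).2.
Qed.

Lemma polish_second_countable : polish X -> exists O : nat -> set X,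
  forall (x : X) U, nbhs x U -> exists n, nbhs x (O n) /\ O n `<=` U.
Proof.
move=> [[D [/countable_injP[i i_inj] Dd]] [d [dm dopen _]]].
have [d0 dxx dC dtri] := dm.
pose ball x n := [set y | Rlt (d x y) (Rinv (Raxioms.INR n))].
pose O m : set X := if CodeSeq.decode m is [:: a; n]
  then [set y | exists x, [/\ D x, i x = a & ball x n y]] else set0.
exists O => x U; rewrite {1}nbhsE => -[V [oV Vx] VU].
have [e [e0 eV]] := (dopen V).1 oV x Vx.
(* Half of [e]: the ball used is centred at a nearby point of the dense set, so its points are
   within twice the radius of [x]. *)
have [n [ne n0]] : exists n, Rlt (Rinv (Raxioms.INR n)) (Rdiv e (Rplus R1 R1)) /\ lt 0 n.
  by apply: Rtrigo_def.archimed_cor1; Lra.lra.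
have n0' : Rlt R0 (Rinv (Raxioms.INR n)).
  by apply: RIneq.Rinv_0_lt_compat; exact: RIneq.lt_0_INR.
have : closure D x by rewrite Dd.
move=> /(_ _ (nbhs_ball x dm dopen n0')) [a [Da xa]].
exists (CodeSeq.code [:: i a; n]); rewrite /O CodeSeq.codeK; split.
  apply: (@filterS _ _ _ (ball a n)); first by move=> y ay; exists a.
  by apply: open_nbhs_nbhs; split; [exact: open_ball|rewrite /ball /= dC].
move=> y [b [Db /i_inj ba yb]]; apply: VU; apply: eV => /=.
have {ba} ba : b = a by apply: ba; rewrite inE.
rewrite ba in yb; move: xa yb; rewrite /ball /= => xa ay.
by have := dtri x a y; Lra.lra.
Qed.

(** Choose one clopen set between [O m] and [O n] for each pair admitting one. Countably many sets
    result, and they still form a basis because the given clopen basis shows which pairs admit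
    one. *)
Lemma clopen_bits : polish X -> zero_dim X ->
  exists bit : nat -> X -> bool,
  [/\ forall n (x : X), \forall y \near x, bit n y = bit n x,
      forall x y, (forall n, bit n x = bit n y) -> x = y &
      forall (x : X) U, nbhs x U ->
        exists n, bit n x /\ forall y, bit n y -> U y].
Proof.
move=> pX [B [Bclopen [_ Bbasis]]].
have [O OP] := polish_second_countable pX.
have ex_C (q : nat * nat) : exists C : set X, clopen C /\
    forall E, clopen E -> O q.1 `<=` E -> E `<=` O q.2 ->
      O q.1 `<=` C /\ C `<=` O q.2.
  have [[E [cE OE EO]]|nE] :=
    pselect (exists E, [/\ clopen E, O q.1 `<=` E & E `<=` O q.2]).
    by exists E.
  (* Default for pairs with no clopen set in between. *)
  exists setT; split; first exact: clopenT.
  by move=> E cE OE EO; case: nE; exists E.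
have [C CP] := choice ex_C.
have basisC (x : X) U : nbhs x U -> exists q, C q x /\ C q `<=` U.
  move=> /OP[n [xn nU]]; have [E [BE Ex] En] := Bbasis x _ xn.
  have cE := Bclopen _ BE; have [oE _] := cE.
  have [m [xm mE]] := OP x E (open_nbhs_nbhs (conj oE Ex)).
  have [_ /(_ E cE mE En)[mC Cn]] := CP (m, n).
  by exists (m, n); split; [exact: mC (nbhs_singleton xm)|exact: subset_trans nU].
exists (fun n x => `[< C (head 0 (CodeSeq.decode n), last 0 (CodeSeq.decode n)) x >]).
have basis' (x : X) U : nbhs x U -> exists n,
    `[< C (head 0 (CodeSeq.decode n), last 0 (CodeSeq.decode n)) x >] /\
    forall y, `[< C (head 0 (CodeSeq.decode n), last 0 (CodeSeq.decode n)) y >] -> U y.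
  move=> /basisC[[m n] [Cx CU]]; exists (CodeSeq.code [:: m; n]).
  by rewrite CodeSeq.codeK /=; split=> [|y /asboolP /CU//]; apply/asboolP.
split=> // [n x|x y eq].
  set q := (_, _); have [[oC cC] _] := CP q.
  have [Cx|nCx] := pselect (C q x).
    have : nbhs x (C q) by apply: open_nbhs_nbhs.
    by apply: filterS => y Cy; rewrite !asboolT.
  have : nbhs x (~` C q) by apply: open_nbhs_nbhs; split=> //; exact: closed_openC.
  by apply: filterS => y Cy; rewrite !asboolF.
apply: contrapT => xy; case: pX => _ [d [dm dopen _]].
have [d0 dxx _ _] := dm.
have dxy : Rlt R0 (d x y).
  by case: (RIneq.Rle_lt_or_eq_dec _ _ (d0 x y)) => // e; case: xy; apply/dxx.
have [n [nx /(_ y)]] := basis' x _ (nbhs_ball x dm dopen dxy).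
by rewrite -eq => /(_ nx) /=; Lra.lra.
Qed.

End Bits.

Theorem theorem9p1
  (G : Type) (mul : G -> G -> G) (one : G) (inv : G -> G)
  (Hgrp : is_group mul one inv) (Hcount : countable_type G)
  (Hln : locally_nilpotent mul one inv)
  (X : topologicalType) (HX : polish X) (Hzd : zero_dim X)
  (act : G -> X -> X)
  (Hact1 : forall x, act one x = x)
  (HactM : forall g h x, act (mul g h) x = act g (act h x))
  (Hfree : forall g x, act g x = x -> g = one)
  (Hcont : forall g, continuous (act g)) :
  exists f : X -> cantor_space,
    [/\ continuous f, injective f &
        forall x y, (exists g, act g x = y) <-> E0 (f x) (f y)].
Proof.
have [mulA mul1 mulr1 mulV mulrV] := Hgrp.
pose cT : choiceType := HB.pack G (gen_eqMixin G) (gen_choiceMixin G).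
pose gT : groupType := HB.pack (cT : Type) (Choice.class cT)
  (isGroup.Build cT mulA mul1 mulr1 mulV mulrV).
have [bit [bit_loc bit_sep bit_basis]] := clopen_bits HX Hzd.
have [num num_inj] := Hcount.
exact: (@locally_nilpotent_coding gT X act Hact1 HactM Hfree Hcont bit
  bit_loc bit_sep bit_basis num num_inj Hln).
Qed.
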